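(* Let $1\le p<\infty$, let $k\ge1$ be a fixed integer, and for each $N\ge k$ let $X=X_N$ have the $p$-Generalized Dirichlet distribution on $\mathbb{B}_{N,p}$ with parameter $(\mathbf a,\mathbf b)=(a_1,\dots,a_N,b_1,\dots,b_N)$ (all positive), where $a_1,\dots,a_k$ do not depend on $N$ while the $b_j=b_j^{(N)}$ may depend on $N$. Let $X^{(k)}=(X_1,\dots,X_k)$ be the vector of the first $k$ coordinates of $X$. Assume that, for $j=1,\dots,k$, $p\,b_j=N+o(N)$ as $N\to\infty$. Then $$N^{1/p}X^{(k)}\xrightarrow[N\to\infty]{(d)}\big(\varepsilon_1Z_1^{1/p},\dots,\varepsilon_kZ_k^{1/p}\big),$$ where $\varepsilon_1,\dots,\varepsilon_k,Z_1,\dots,Z_k$ are independent, the $\varepsilon_j$ are Rademacher distributed, and for $j=1,\dots,k$, $Z_j\stackrel{d}{=}\gamma(a_j,1/p)$. In other words, $\varepsilon_jZ_j^{1/p}$ has density $$x\mapsto\frac{p^{1-a_j}}{2\Gamma(a_j)}|x|^{pa_j-1}\exp(-|x|^p/p),\qquad x\in\mathbb{R}.$$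
   Context: $\mathbb{B}_{N,p}=\{x\in\mathbb{R}^N:\|x\|_p=(\sum_{i=1}^N|x_i|^p)^{1/p}<1\}$. $\mathcal{S}_N^<=\{(x_1,\dots,x_N):x_i>0\ \forall i,\ \sum_i x_i<1\}$, and $\mathcal{GD}_{\mathbf a,\mathbf b}$ is the probability distribution on $\mathcal{S}_N^<$ with Lebesgue density $$\frac1{\mathcal{Z}(\mathbf a,\mathbf b)}\,p_{N+1}^{b_N-1}\prod_{j=1}^N\Big[p_j^{a_j-1}(1-p_1-\dots-p_{j-1})^{b_{j-1}-(a_j+b_j)}\Big],\qquad p_{N+1}=1-p_1-\dots-p_N,$$ with $\mathcal{Z}(\mathbf a,\mathbf b)=\prod_{j=1}^N\Gamma(a_j)\Gamma(b_j)/\Gamma(a_j+b_j)$ (for $j=1$ the base of the last power is $1$, so $b_0$ plays no role). The $p$-Generalized Dirichlet distribution on $\mathbb{B}_{N,p}$ with parameter $(\mathbf a,\mathbf b)$ is the law of $(\varepsilon_1\rho_1^{1/p},\dots,\varepsilon_N\rho_N^{1/p})$, where $(\rho_1,\dots,\rho_N)$ has distribution $\mathcal{GD}_{\mathbf a,\mathbf b}$ and the $\varepsilon_i$ are independent Rademacher variables ($\pm1$ with probability $1/2$), independent of $(\rho_1,\dots,\rho_N)$. For $a,\lambda>0$, $\gamma(a,\lambda)$ is the distribution with density $y\mapsto\frac{\lambda^a}{\Gamma(a)}y^{a-1}e^{-\lambda y}$ on $(0,\infty)$. $\xrightarrow{(d)}$ denotes convergence in distribution. *)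

(* Defs.v *)
From HB Require Import structures.
From mathcomp Require Import all_boot all_order all_algebra.
From mathcomp Require Import all_classical all_reals all_analysis.

Set Implicit Arguments.
Unset Strict Implicit.
Unset Printing Implicit Defensive.

Import Order.TTheory GRing.Theory Num.Theory.
Import numFieldNormedType.Exports.

Local Open Scope classical_set_scope.
Local Open Scope ring_scope.

(* Random vectors take values in [n.-tuple R], which carries the product
   sigma-algebra; continuity lives on ['rV[R]_n], which carries the topology. *)
Definition tuple_row (R : realType) (n : nat) (t : n.-tuple R) : 'rV[R]_n :=
  \row_i tnth t i.

Definition cons_pair (T : Type) (n : nat) (xt : T * n.-tuple T) :
  n.+1.-tuple T := [the n.+1.-tuple T of xt.1 :: xt.2].

(* n-dimensional Lebesgue measure. *)
Fixpoint lebesgue_tuple (R : realType) (n : nat) : set (n.-tuple R) -> \bar R :=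
  match n with
  | 0 => \d_[tuple]
  | m.+1 => pushforward
      (@lebesgue_measure R \x @lebesgue_tuple R m)%E (@cons_pair _ m)
  end.
Arguments lebesgue_tuple {R} n.

Section lebesgue_tuple_measure.
Context {R : realType}.
Local Notation tR := (measurableTypeR R).
Local Open Scope ereal_scope.

Lemma measurable_cons_pair (n : nat) :
  measurable_fun [set: tR * n.-tuple R]
    (@cons_pair R n : tR * n.-tuple R -> n.+1.-tuple R).
Proof. exact: measurable_cons. Qed.

Lemma sigma_finite_product d1 d2 (T1 : measurableType d1)
    (T2 : measurableType d2) (m1 : {sigma_finite_measure set T1 -> \bar R})
    (m2 : {sigma_finite_measure set T2 -> \bar R}) :
  sigma_finite setT (m1 \x m2).
Proof.
have /sigma_finiteP[F [TF ndF Foo]] := sigma_finiteT m1.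
have /sigma_finiteP[G [TG ndG Goo]] := sigma_finiteT m2.
exists (fun n => F n `*` G n).
  rewrite -setXTT TF TG predeqE => -[x y]; split.
    move=> [/= [n _ Fnx] [k _ Gky]]; exists (maxn n k) => //; split.
    - by move: x Fnx; exact/subsetPset/ndF/leq_maxl.
    - by move: y Gky; exact/subsetPset/ndG/leq_maxr.
  by move=> [n _ []/= ? ?]; split; exists n.
move=> k; have [? ?] := Foo k; have [? ?] := Goo k.
split; first exact: measurableX.
by rewrite product_measure1E// lte_mul_pinfty// ge0_fin_numE.
Qed.

Lemma lebesgue_tuple_sigma_finite_measure (n : nat) :
  exists m : {sigma_finite_measure set (n.-tuple R) -> \bar R},
    m = lebesgue_tuple n :> (set (n.-tuple R) -> \bar R).
Proof.
elim: n => [|n [m mE]].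
  by exists (\d_[tuple] : {sigma_finite_measure set (0.-tuple R) -> \bar R}).
pose pm : {measure set _ -> \bar R} := (@lebesgue_measure R \x m).
have spm : sigma_finite setT pm by exact: sigma_finite_product.
have mc := @measurable_cons_pair n.
pose q : {measure set (n.+1.-tuple R) -> \bar R} :=
  measure_function_pushforward__canonical__measure_function_Measure pm mc.
have qE : q = lebesgue_tuple n.+1 :> (set (n.+1.-tuple R) -> \bar R).
  by rewrite /= -mE.
have sq : sigma_finite setT q.
  have [F FT Ffin] := spm.
  pose u (t : n.+1.-tuple R) : tR * n.-tuple R := (thead t, [tuple of behead t]).
  have mu : measurable_fun setT u.
    apply: measurable_fun_pair; last exact: measurable_behead.
    exact: measurable_tnth.
  have uK x : u (cons_pair x) = x.
    by case: x => x t; rewrite /u /cons_pair /= theadE; congr pair; apply: val_inj.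
  exists (fun i => u @^-1` F i).
    by rewrite -preimage_bigcup -FT preimage_setT.
  move=> i; have [mF Fy] := Ffin i; split.
    by rewrite -[X in measurable X]setTI; exact: mu.
  rewrite [X in X < _](_ : _ = pm (F i))//.
  rewrite /q /= /pushforward; congr (pm _).
  by apply/seteqP; split=> x /=; rewrite uK.
pose s := @Measure_isSigmaFinite.Build _ _ _ q sq.
pose qs : {sigma_finite_measure set (n.+1.-tuple R) -> \bar R} :=
  HB.pack (q : set (n.+1.-tuple R) -> \bar R) (Measure.class q) s.
by exists qs.
Qed.

Lemma lebesgue_tuple0 n : lebesgue_tuple n (set0 : set (n.-tuple R)) = 0.
Proof. by have [m <-] := lebesgue_tuple_sigma_finite_measure n. Qed.

Lemma lebesgue_tuple_ge0 n (A : set (n.-tuple R)) : 0 <= lebesgue_tuple n A.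
Proof. by have [m <-] := lebesgue_tuple_sigma_finite_measure n. Qed.

Lemma lebesgue_tuple_sigma_additive n :
  semi_sigma_additive (@lebesgue_tuple R n).
Proof.
have [m <-] := lebesgue_tuple_sigma_finite_measure n.
exact: measure_semi_sigma_additive.
Qed.

HB.instance Definition _ n := isMeasure.Build _ _ _ (@lebesgue_tuple R n)
  (lebesgue_tuple0 n) (@lebesgue_tuple_ge0 n)
  (@lebesgue_tuple_sigma_additive n).

Lemma lebesgue_tuple_sigma_finite n : sigma_finite setT (@lebesgue_tuple R n).
Proof.
have [m <-] := lebesgue_tuple_sigma_finite_measure n; exact: sigma_finiteT.
Qed.

HB.instance Definition _ n := Measure_isSigmaFinite.Build _ _ _
  (@lebesgue_tuple R n) (lebesgue_tuple_sigma_finite n).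

Lemma lebesgue_tuple_box (n : nat) (A : 'I_n -> set R) :
  (forall i, measurable (A i)) ->
  lebesgue_tuple n [set t | forall i, A i (tnth t i)] =
  \prod_(i < n) lebesgue_measure (A i).
Proof.
elim: n A => [|n IH] A mA.
  rewrite big_ord0 /= diracE.
  by rewrite mem_set// => -[].
rewrite big_ord_recl -(IH (fun i => A (lift ord0 i)))//.
rewrite -product_measure1E//; last first.
  rewrite (_ : [set t | _] =
    \bigcap_(i in [set: 'I_n]) ((@tnth _ R ^~ i) @^-1` A (lift ord0 i))).
    apply: fin_bigcap_measurable => // i _.
    by rewrite -[X in measurable X]setTI; exact: measurable_tnth.
  by apply/seteqP; split => t /= h i; [move=> _|]; exact: h.
  exact: (mA ord0).
rewrite /= /pushforward; congr ((_ \x _) _).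
apply/seteqP; split => -[x t] /=.
  move=> h; split; first exact: (h ord0).
  by move=> i; have := h (lift ord0 i); rewrite tnthS.
move=> [h0 h] i; case: (unliftP ord0 i) => [j|] ->; last exact: h0.
by rewrite tnthS; exact: h.
Qed.

End lebesgue_tuple_measure.

(* Euler's integral; used for [0 < a] only. *)
Definition Gamma_fun (R : realType) (a : R) : R :=
  \int[lebesgue_measure]_(t in `]0%R, +oo[) (t `^ (a - 1) * expR (- t)).

Definition has_density (R : realType) (d d' : measure_display)
    (T : measurableType d) (T' : measurableType d') (P : probability T R)
    (mu : set T' -> \bar R) (X : T -> T') (f : T' -> R) : Prop :=
  forall A : set T', measurable A ->
    P (X @^-1` A) = (\int[mu]_(x in A) (f x)%:E)%E.

Definition same_law (R : realType) (d1 d2 d' : measure_display)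
    (T1 : measurableType d1) (T2 : measurableType d2) (T' : measurableType d')
    (P1 : probability T1 R) (P2 : probability T2 R)
    (X1 : T1 -> T') (X2 : T2 -> T') : Prop :=
  forall A : set T', measurable A -> P1 (X1 @^-1` A) = P2 (X2 @^-1` A).

Definition sigma_generated (d d' : measure_display)
    (T : measurableType d) (T' : measurableType d') (X : T -> T') :
    set_system T :=
  preimage_set_system setT X measurable.

Definition mutually_independent (R : realType) (d : measure_display)
    (T : measurableType d) (P : probability T R) (I : finType)
    (F : I -> set_system T) : Prop :=
  forall (J : {set I}) (A : I -> set T),
    (forall i, i \in J -> F i (A i)) ->
    P (\bigcap_(i in [set` J]) A i) = (\prod_(i in J) P (A i))%E.

Definition rademacher (R : realType) (d : measure_display)
    (T : measurableType d) (P : probability T R) (eps : T -> R) : Prop :=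
  P [set w | eps w = 1] = (2^-1)%:E /\ P [set w | eps w = -1] = (2^-1)%:E.

Definition gamma_pdf (R : realType) (a lambda y : R) : R :=
  if 0 < y
  then lambda `^ a / Gamma_fun a * y `^ (a - 1) * expR (- (lambda * y))
  else 0.

(* Coordinates are numbered from 0: [a j], [b j] and [tnth x j] stand for
   a_{j+1}, b_{j+1} and x_{j+1}. *)
Definition open_simplex (R : realType) (N : nat) : set (N.-tuple R) :=
  [set x | (forall i, 0 < tnth x i) /\ \sum_(i < N) tnth x i < 1].

Definition gd_norm (R : realType) (N : nat) (a b : nat -> R) : R :=
  \prod_(j < N) (Gamma_fun (a j) * Gamma_fun (b j) / Gamma_fun (a j + b j)).

(* For j = 0 the base of the last power is 1, so that the value of [b j.-1] is
   irrelevant there. *)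
Definition gd_pdf (R : realType) (N : nat) (a b : nat -> R) (x : N.-tuple R) :
    R :=
  \1_(@open_simplex R N) x *
  ((gd_norm N a b)^-1 *
   (1 - \sum_(i < N) tnth x i) `^ (b N.-1 - 1) *
   \prod_(j < N) (tnth x j `^ (a j - 1) *
     (1 - \sum_(i < N | (i < j)%N) tnth x i) `^ (b j.-1 - (a j + b j)))).

(* The [N + 1] random elements eps_0, ..., eps_{N-1} and the whole vector rho
   (index [None]) are mutually independent. *)
Definition p_generalized_dirichlet (R : realType) (p : R) (N : nat)
    (a b : nat -> R) (d : measure_display) (T : measurableType d)
    (P : probability T R) (X : {RV P >-> N.-tuple R}) : Prop :=
  exists (d' : measure_display) (T' : measurableType d')
    (Q : probability T' R) (rho : {RV Q >-> N.-tuple R})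
    (eps : 'I_N -> {RV Q >-> R}),
    [/\ has_density Q (lebesgue_tuple N) rho (gd_pdf a b),
        forall i, rademacher Q (eps i),
        mutually_independent Q (fun o : option 'I_N =>
          if o is Some i then sigma_generated (eps i)
          else sigma_generated rho) &
        same_law P Q X
          (fun w => [tuple eps i w * tnth (rho w) i `^ p^-1 | i < N])].

Definition cvg_in_distribution (R : realType) (n : nat)
    (d : nat -> measure_display) (T : forall N, measurableType (d N))
    (P : forall N, probability (T N) R) (X : forall N, T N -> n.-tuple R)
    (d' : measure_display) (T' : measurableType d') (Q : probability T' R)
    (Y : T' -> n.-tuple R) : Prop :=
  forall f : 'rV[R]_n -> R, continuous f -> bounded_fun f ->
    ('E_(P N)[fun w => f (tuple_row (X N w))])%E @[N --> \oo] -->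
    ('E_Q[fun w => f (tuple_row (Y w))])%E.

(* Main.v *)
Require Import Defs.
From HB Require Import structures.
From mathcomp Require Import all_boot all_order all_algebra.
From mathcomp Require Import all_classical all_reals all_analysis.
From mathcomp Require Import measurable_realfun ring lra.

Import Order.TTheory GRing.Theory Num.Theory.
Import numFieldNormedType.Exports.

Local Open Scope classical_set_scope.
Local Open Scope ring_scope.

(* Stick breaking: under GD_{a,b} the first coordinate has law Beta(a_1, b_1)
   and, given it, the rest is a generalized Dirichlet vector of one dimension
   less, scaled to the remaining length.  Starting from a stick of length N, the
   first piece has density B(a_1, b_1)^-1 x^(a_1 - 1) N^-a_1 (1 - x/N)^(b_1 - 1)
   on (0, N), which tends to the gamma(a_1, 1/p) density, since p b_1 ~ N, and is
   dominated by a multiple of x^(a_1 - 1) exp(-x / (2p)); the remaining length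
   N - x is still equivalent to N.  So dominated convergence in one variable and
   induction on k show that the expectation of any bounded measurable function of
   N (rho_1, ..., rho_k) converges; averaging over the signs gives the result.
   That no Gamma value involved is infinite or zero is not proved analytically:
   it follows from the densities having total mass 1. *)

(** * Integration against a density; affine changes of variables *)

(** Everything is phrased with integrals of nonnegative extended-real functions, so that Tonelli and
    monotone convergence apply without integrability side conditions; a bounded test function is
    first raised by one of its bounds. Given the first piece [x], the inner integral is the same
    problem for the lengths [m n - x]. Hence the induction has to allow any sequence of lengths
    tending to infinity, and the one-dimensional limit has to allow test functions that depend on
    [n]. No Stirling estimate enters: each kernel has mass 1, so its normalizing constant is the
    inverse of an integral to which dominated convergence applies. The mass argument for the Gamma
    values rests on two conventions. [Gamma_fun] is the [fine] part of an integral, hence 0 when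
    that integral diverges, and [0^-1 = 0]; a degenerate Gamma value therefore makes a whole density
    vanish, which mass 1 forbids. Conversely, a nonzero value is finite and positive, and this is
    the form in which finiteness travels through the proof. *)

Section integral_density.
Local Open Scope ereal_scope.
Context d (T : measurableType d) (R : realType).
Variables (mu nu : {measure set T -> \bar R}) (h : T -> R).
Hypotheses (mh : measurable_fun setT h) (h0 : forall x, (0 <= h x)%R).
Hypothesis nuE : forall A, measurable A -> nu A = \int[mu]_(x in A) (h x)%:E.

Import HBNNSimple.

Let integral_density_nnsfun (f : {nnsfun T >-> R}) :
  \int[nu]_x (f x)%:E = \int[mu]_x ((f x)%:E * (h x)%:E).
Proof.
rewrite integralT_nnsfun sintegralE.
have mi r : measurable_fun setT
    ((fun x => (r * \1_(f @^-1` [set r]) x)%:E) : T -> \bar R).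
  by apply/measurable_EFinP; exact: measurable_funM.
transitivity (\int[mu]_x (\sum_(y \in range f)
    (y * \1_(f @^-1` [set y]) x)%:E * (h x)%:E)); last first.
  apply: eq_integral => x _.
  rewrite -ge0_mule_fsuml => [|y]; last exact: nnfun_muleindic_ge0.
  by rewrite fsumEFin// -(fimfunE _ x).
rewrite ge0_integral_fsum//; last 2 first.
- by move=> y; apply: emeasurable_funM => //; exact/measurable_EFinP.
- by move=> m y Ey; rewrite mule_ge0 ?lee_fin// -lee_fin nnfun_muleindic_ge0.
apply: eq_fsbigr => r /set_mem [y _ fyr].
under eq_integral do rewrite EFinM -muleA.
rewrite ge0_integralZl//; last 3 first.
- by apply: emeasurable_funM; exact/measurable_EFinP.
- by move=> t _; rewrite mule_ge0 ?lee_fin.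
- by rewrite lee_fin -fyr.
congr (_ * _); rewrite nuE//.
under [RHS]eq_integral do rewrite muleC.
rewrite integral_mkcond; apply: eq_integral => x _.
by rewrite epatch_indic.
Qed.

(** Level sets of simple functions are handled by [nuE]; monotone convergence along [nnsfun_approx],
    on both sides, gives the rest. *)
Lemma ge0_integral_density (g : T -> \bar R) :
  measurable_fun setT g -> (forall x, 0 <= g x) ->
  \int[nu]_x g x = \int[mu]_x (g x * (h x)%:E).
Proof.
move=> mg g0; pose g_ := nnsfun_approx measurableT mg.
have cg x : (g_ n x)%:E @[n --> \oo] --> g x by exact: cvg_nnsfun_approx.
transitivity (limn (fun n => \int[nu]_x (g_ n x)%:E)).
  rewrite -monotone_convergence//.
  - by apply: eq_integral => x _; apply/esym/cvg_lim.
  - by move=> n; exact/measurable_EFinP.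
  - by move=> n x _; rewrite lee_fin.
  - by move=> x _ m n mn; rewrite lee_fin; exact/lefP/nd_nnsfun_approx.
under eq_fun do rewrite integral_density_nnsfun.
rewrite -monotone_convergence//.
- by apply: eq_integral => x _; apply/cvg_lim => //; exact: cvgeZr.
- by move=> n; apply: emeasurable_funM; exact/measurable_EFinP.
- by move=> n x _; rewrite mule_ge0 ?lee_fin.
- move=> x _ m n mn; rewrite lee_wpmul2r ?lee_fin//.
  exact/lefP/nd_nnsfun_approx.
Qed.

End integral_density.
Arguments ge0_integral_density {d T R} mu nu h.

Section lebesgue_affine.
Local Open Scope ereal_scope.
Context (R : realType).
Local Notation mu := (@lebesgue_measure R).
Local Notation tR := (measurableTypeR R).

(** The image of Lebesgue measure under a translation gives half-open intervals their length, which
    characterizes Lebesgue measure. *)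
Lemma ge0_integral_lebesgue_shift (c : R) (f : tR -> \bar R) :
  measurable_fun setT f -> (forall x, 0 <= f x) ->
  \int[mu]_x f (x + c)%R = \int[mu]_x f x.
Proof.
move=> mf f0.
have mc : measurable_fun setT ((fun x => x + c)%R : tR -> tR).
  exact: measurable_funD.
pose nu : {measure set tR -> \bar R} :=
  measure_function_pushforward__canonical__measure_function_Measure mu mc.
transitivity (\int[nu]_x f x); last first.
  apply: eq_measure_integral => A mA _; apply/esym.
  apply: lebesgue_measure_unique => //= _ [[a b]] _ <-.
  rewrite /pushforward (_ : _ @^-1` _ = `](a - c)%R, (b - c)%R]%classic).
    rewrite !lebesgue_measure_itv/= !lte_fin ltrD2r -!EFinB.
    by case: ifP => // _; congr EFin; ring.
  by apply/seteqP; split => x; rewrite /= !in_itv/= ltrBlDr lerBrDr.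
by rewrite ge0_integral_pushforward.
Qed.

(** The image of Lebesgue measure under [x -> c x] divides lengths by [c]; the weight [c] of
    [mscale] restores them, and uniqueness applies again. *)
Lemma ge0_integral_lebesgue_scale (c : R) (f : tR -> \bar R) : (0 < c)%R ->
  measurable_fun setT f -> (forall x, 0 <= f x) ->
  c%:E * \int[mu]_x f (c * x)%R = \int[mu]_x f x.
Proof.
move=> c0 mf f0.
have mc : measurable_fun setT ((fun x => c * x)%R : tR -> tR).
  exact: measurable_funM.
pose push : {measure set tR -> \bar R} :=
  measure_function_pushforward__canonical__measure_function_Measure mu mc.
pose nu : {measure set tR -> \bar R} := mscale (NngNum (ltW c0)) push.
transitivity (\int[nu]_x f x); last first.
  apply: eq_measure_integral => A mA _; apply/esym.
  apply: lebesgue_measure_unique => //= _ [[a b]] _ <-.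
  rewrite /mscale/= /pushforward.
  rewrite (_ : _ @^-1` _ = `](c^-1 * a)%R, (c^-1 * b)%R]%classic).
    rewrite !lebesgue_measure_itv/= !lte_fin ltr_pM2l ?invr_gt0//.
    case: ifP => _; last by rewrite mule0.
    by rewrite -!EFinD -EFinM; congr EFin; field; rewrite gt_eqF.
  apply/seteqP; split => x; rewrite /= !in_itv/=.
    by rewrite ltr_pdivrMl// ler_pdivlMl.
  by rewrite ltr_pdivrMl// ler_pdivlMl.
by rewrite ge0_integral_mscale// ge0_integral_pushforward.
Qed.

End lebesgue_affine.

(** * Gamma and Beta integrals *)

Lemma gt0_powRD (R : realType) (x r s : R) : 0 < x ->
  x `^ (r + s) = x `^ r * x `^ s.
Proof. by move=> x0; rewrite powRD// (gt_eqF x0) implybT. Qed.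

Section ppow.
Context (R : realType).
Implicit Types a m x c : R.

(** The cut-off carries the support inside the integrand, so that all Gamma and Beta integrals run
    over the whole line and substitutions leave the domain alone. It is needed because [powR] does
    not vanish at negative bases. *)
Definition ppow a x : R := if 0 < x then x `^ (a - 1) else 0.

Lemma ppow_ge0 a x : 0 <= ppow a x.
Proof. by rewrite /ppow; case: ifP => // _; exact: powR_ge0. Qed.

Lemma ppowE a x : 0 < x -> ppow a x = x `^ (a - 1).
Proof. by rewrite /ppow => ->. Qed.

Lemma ppow_le0 a x : x <= 0 -> ppow a x = 0.
Proof. by rewrite /ppow ltNge => ->. Qed.

Lemma ppowM a c x : 0 < c -> ppow a (c * x) = c `^ (a - 1) * ppow a x.
Proof.
move=> c0; rewrite /ppow pmulr_rgt0//; case: ifPn => x0; last by rewrite mulr0.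
by rewrite powRM// ltW.
Qed.

Lemma measurable_ppow a d (T : measurableType d) (f : T -> R) :
  measurable_fun setT f -> measurable_fun setT (fun t => ppow a (f t)).
Proof.
move=> mf; apply: measurable_fun_ifT => //; first exact: measurable_fun_ltr.
exact: (measurableT_comp (measurable_powR _)).
Qed.

End ppow.
Arguments ppow {R}.

Section gamma_beta.
Local Open Scope ereal_scope.
Context (R : realType).
Local Notation mu := (@lebesgue_measure R).
Local Notation tR := (measurableTypeR R).
Implicit Types a b m : R.

(** Euler's integral before [fine] is applied: it may still be infinite. *)
Definition egamma a : \bar R := \int[mu]_x (ppow a x * expR (- x))%:E.

Lemma measurable_ppow_expR a c :
  measurable_fun setT (fun x : tR => (ppow a x * expR (- (c * x)))%:E).
Proof.
apply/measurable_EFinP; apply: measurable_funM; first exact: measurable_ppow.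
by apply: measurableT_comp => //; apply: measurableT_comp => //; exact: measurable_funM.
Qed.

Lemma measurable_ppow_expRN a :
  measurable_fun setT (fun x : tR => (ppow a x * expR (- x))%:E).
Proof.
by under eq_fun do rewrite -[X in expR (- X)]mul1r; exact: measurable_ppow_expR.
Qed.

Lemma Gamma_funE a : Gamma_fun a = fine (egamma a).
Proof.
rewrite /Gamma_fun /Rintegral /egamma integral_mkcond; congr fine.
apply: eq_integral => x _; rewrite patchE /ppow mem_setE in_itv/= andbT.
by case: ifP => //; rewrite mul0r.
Qed.

Lemma egamma_ge0 a : 0 <= egamma a.
Proof.
by apply: integral_ge0 => x _; rewrite lee_fin mulr_ge0 ?ppow_ge0 ?expR_ge0.
Qed.

(** [fine] sends infinite values to 0, so a nonzero [Gamma_fun] certifies that the integral is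
    finite. *)
Lemma egamma_fin a : Gamma_fun a != 0%R -> egamma a = (Gamma_fun a)%:E.
Proof. by rewrite Gamma_funE; case: (egamma a) => //=; rewrite eqxx. Qed.

Lemma Gamma_fun_gt0 a : Gamma_fun a != 0%R -> (0 < Gamma_fun a)%R.
Proof. by move=> G0; rewrite lt_def G0 Gamma_funE fine_ge0// egamma_ge0. Qed.

(** Euler's Beta integral on a stick of length [m]; the two cut-offs confine [x] to the interval
    from 0 to [m]. *)
Definition ebeta a b m : \bar R := \int[mu]_x (ppow a x * ppow b (m - x))%:E.

Lemma measurable_ppow_sub b d (T : measurableType d) (f g : T -> R) :
  measurable_fun setT f -> measurable_fun setT g ->
  measurable_fun setT (fun t => ppow b (f t - g t)).
Proof. by move=> mf mg; apply: measurable_ppow; exact: measurable_funB. Qed.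

Lemma ebeta_ge0 a b m : 0 <= ebeta a b m.
Proof.
by apply: integral_ge0 => x _; rewrite lee_fin mulr_ge0 ?ppow_ge0.
Qed.

Lemma ppow_ppow0 a b m x : (m <= 0)%R -> (ppow a x * ppow b (m - x) = 0)%R.
Proof.
move=> m0; have [x0|x0] := leP x 0%R; first by rewrite ppow_le0// mul0r.
by rewrite (ppow_le0 _ b) ?mulr0// subr_le0 (le_trans m0)// ltW.
Qed.

(** Homogeneity under [x -> m x]: the powers contribute [(a - 1) + (b - 1)] and the Jacobian 1. *)
Lemma ebetaE a b m : (0 < m)%R ->
  ebeta a b m = (m `^ (a + b - 1))%:E * ebeta a b 1.
Proof.
move=> m0; rewrite /ebeta; set f := fun x : tR => (ppow a x * ppow b (m - x))%:E.
transitivity (m%:E * \int[mu]_x f (m * x)%R).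
  apply/esym/ge0_integral_lebesgue_scale => //.
    apply/measurable_EFinP; apply: measurable_funM; first exact: measurable_ppow.
    exact: measurable_ppow_sub.
  by move=> x; rewrite lee_fin mulr_ge0 ?ppow_ge0.
rewrite /f; under eq_integral => x _.
  rewrite -[X in (X - m * x)%R]mulr1 -mulrBr !ppowM// mulrACA EFinM.
  over.
rewrite ge0_integralZl//; last 3 first.
- apply/measurable_EFinP; apply: measurable_funM; first exact: measurable_ppow.
  exact: measurable_ppow_sub.
- by move=> x _; rewrite lee_fin mulr_ge0 ?ppow_ge0.
- by rewrite lee_fin mulr_ge0 ?powR_ge0.
rewrite muleA -EFinM; congr (_%:E * _).
rewrite -{1}[m]powRr1 ?ltW// -!gt0_powRD//.
by congr (_ `^ _)%R; ring.
Qed.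

(* Both sides are the integral of s^(a-1) (u-s)^(b-1) e^(-u) over 0 < s < u. *)
Lemma egammaM a b : egamma a * egamma b = ebeta a b 1 * egamma (a + b).
Proof.
pose f (z : tR * tR) : \bar R :=
  (ppow a z.1 * ppow b (z.2 - z.1) * expR (- z.2))%:E.
have mf : measurable_fun setT f.
  apply/measurable_EFinP; apply: measurable_funM; last first.
    by apply: measurableT_comp => //; exact: measurableT_comp.
  apply: measurable_funM; first exact: measurable_ppow.
  exact: measurable_ppow_sub.
have f0 z : 0 <= f z by rewrite lee_fin !mulr_ge0 ?ppow_ge0 ?expR_ge0.
transitivity (\int[mu]_x \int[mu]_y f (x, y)).
  rewrite {1}/egamma -ge0_integralZr//; last 3 first.
  - exact: measurable_ppow_expRN.
  - by move=> x _; rewrite lee_fin mulr_ge0 ?ppow_ge0 ?expR_ge0.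
  - exact: egamma_ge0.
  apply: eq_integral => x _; rewrite /egamma.
  (* Translating the second variable by [x] turns it into the total [u = s + (u - s)], with [s = x];
     the two exponentials then merge into one of [u]. *)
  rewrite -[X in _ * X = _](ge0_integral_lebesgue_shift _ (- x)%R)//; last 2 first.
  - exact: measurable_ppow_expRN.
  - by move=> y; rewrite lee_fin mulr_ge0 ?ppow_ge0 ?expR_ge0.
  rewrite -ge0_integralZl//; last 3 first.
  - apply/measurable_EFinP; apply: measurable_funM.
      exact: measurable_ppow_sub.
    apply: measurableT_comp => //; apply: measurableT_comp => //.
    exact: measurable_funD.
  - by move=> y _; rewrite lee_fin mulr_ge0 ?ppow_ge0 ?expR_ge0.
  - by rewrite lee_fin mulr_ge0 ?ppow_ge0 ?expR_ge0.
  apply: eq_integral => y _; rewrite -EFinM /f/=; congr EFin.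
  rewrite [in RHS](_ : - y = - x + - (y - x))%R; last by ring.
  by rewrite expRD; ring.
rewrite (fubini_tonelli f)//.
(* With the total [y] fixed, the integral over [x] is [ebeta a b y], and homogeneity extracts
   [y^(a+b-1)]. *)
transitivity (\int[mu]_y (ebeta a b 1 * (ppow (a + b) y * expR (- y))%:E)).
  apply: eq_integral => y _; rewrite /f/=.
  under eq_integral do rewrite EFinM.
  rewrite ge0_integralZr//; last 2 first.
  - apply/measurable_EFinP; apply: measurable_funM; first exact: measurable_ppow.
    exact: measurable_ppow_sub.
  - by move=> x _; rewrite lee_fin mulr_ge0 ?ppow_ge0.
  change (ebeta a b y * (expR (- y))%:E =
    ebeta a b 1 * (ppow (a + b) y * expR (- y))%:E).
  have [y0|y0] := leP y 0%R; last by rewrite ebetaE// ppowE// muleAC EFinM muleC.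
  rewrite (ppow_le0 _ _ _ y0) mul0r [RHS]mule0 (_ : ebeta a b y = 0) ?mul0e//.
  by apply: integral0_eq => x _; rewrite ppow_ppow0.
rewrite ge0_integralZl//.
- exact: measurable_ppow_expRN.
- by move=> x _; rewrite lee_fin mulr_ge0 ?ppow_ge0 ?expR_ge0.
- exact: ebeta_ge0.
Qed.

Definition beta_norm a b : R := (Gamma_fun a * Gamma_fun b / Gamma_fun (a + b))%R.

(** Since [0^-1 = 0], a nonzero quotient controls its denominator too. *)
Lemma beta_norm_neq0P a b : beta_norm a b != 0%R ->
  [/\ Gamma_fun a != 0%R, Gamma_fun b != 0%R & Gamma_fun (a + b) != 0%R].
Proof.
rewrite /beta_norm; move: (Gamma_fun a) (Gamma_fun b) (Gamma_fun (a + b)).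
by move=> u v w; rewrite !mulf_eq0 invr_eq0 => /norP[/norP[]].
Qed.

Lemma beta_norm_ge0 a b : (0 <= beta_norm a b)%R.
Proof.
have G0 (c : R) : (0 <= Gamma_fun c)%R by rewrite Gamma_funE fine_ge0// egamma_ge0.
by rewrite /beta_norm !mulr_ge0 ?invr_ge0.
Qed.

Lemma ebeta1E a b : beta_norm a b != 0%R -> ebeta a b 1 = (beta_norm a b)%:E.
Proof.
move=> /beta_norm_neq0P[a0 b0 ab0]; have := egammaM a b.
rewrite !egamma_fin//; have := ebeta_ge0 a b 1.
(* An infinite Beta integral would make the right-hand side of [egammaM] infinite, as
   [Gamma_fun (a + b)] is positive, whereas the left-hand side is finite. *)
case: (ebeta a b 1) => [r _|_|//].
  rewrite -2!EFinM => -[GE]; congr EFin; rewrite /beta_norm GE.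
  by field.
by rewrite gt0_mulye// lte_fin Gamma_fun_gt0.
Qed.

(* The law of [m * V] with [V] of Beta distribution B(a, b). *)
Definition beta_kernel a b m x : R :=
  ((beta_norm a b)^-1 * m `^ (1 - (a + b)) * (ppow a x * ppow b (m - x)))%R.

Lemma beta_kernel_ge0 a b m x : (0 <= beta_kernel a b m x)%R.
Proof.
by rewrite /beta_kernel !mulr_ge0 ?invr_ge0 ?beta_norm_ge0 ?powR_ge0 ?ppow_ge0.
Qed.

Lemma measurable_beta_kernel a b d (T : measurableType d) (f g : T -> R) :
  measurable_fun setT f -> measurable_fun setT g ->
  measurable_fun setT (fun t => beta_kernel a b (f t) (g t)).
Proof.
move=> mf mg; apply: measurable_funM.
  apply: measurable_funM => //.
  exact: (measurableT_comp (measurable_powR _)).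
by apply: measurable_funM; [exact: measurable_ppow|exact: measurable_ppow_sub].
Qed.

Lemma beta_kernel0 a b m x : (m <= 0)%R -> beta_kernel a b m x = 0%R.
Proof. by move=> m0; rewrite /beta_kernel ppow_ppow0// mulr0. Qed.

Lemma integral_beta_kernel a b m : beta_norm a b != 0%R -> (0 < m)%R ->
  \int[mu]_x (beta_kernel a b m x)%:E = 1.
Proof.
move=> ab0 m0; under eq_integral do rewrite EFinM.
rewrite ge0_integralZl//; last 3 first.
- apply/measurable_EFinP; apply: measurable_funM; first exact: measurable_ppow.
  exact: measurable_ppow_sub.
- by move=> x _; rewrite lee_fin mulr_ge0 ?ppow_ge0.
- by rewrite lee_fin mulr_ge0 ?powR_ge0// invr_ge0 beta_norm_ge0.
rewrite -/(ebeta a b m) ebetaE// ebeta1E// -!EFinM; congr EFin.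
set u := beta_norm a b in ab0 *.
rewrite [LHS](_ : _ = u^-1 * u * (m `^ (1 - (a + b)) * m `^ (a + b - 1)))%R; last by ring.
rewrite mulVf// mul1r -gt0_powRD//.
by rewrite [X in (_ `^ X)%R](_ : _ = 0%R) ?powRr0//; ring.
Qed.

(** Change of variables for densities: the exponents of [c], namely 1, [1 - (a + b)], [a - 1] and
    [b - 1], add up to 0. *)
Lemma beta_kernelM a b c m x : (0 < c)%R ->
  (c * beta_kernel a b (c * m) (c * x) = beta_kernel a b m x)%R.
Proof.
move=> c0; have [m0|/ltW m0] := leP m 0%R.
  by rewrite !beta_kernel0 ?mulr0// pmulr_rle0.
rewrite /beta_kernel -mulrBr !ppowM// powRM ?(ltW c0)//.
set u := (beta_norm a b)^-1%R; set A := ppow a x; set B := ppow b _.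
rewrite [LHS](_ : _ = (c * c `^ (1 - (a + b)) * c `^ (a - 1) * c `^ (b - 1)) *
  (u * m `^ (1 - (a + b)) * (A * B)))%R; last by ring.
rewrite [X in (X * _)%R](_ : _ = 1)%R ?mul1r//.
rewrite -{1}[c]powRr1 ?ltW// -!gt0_powRD//.
by rewrite [X in (_ `^ X)%R](_ : _ = 0%R) ?powRr0//; ring.
Qed.

End gamma_beta.

Arguments beta_norm {R}.
Arguments beta_kernel {R}.

(** * Stick breaking *)

Section lebesgue_tuple_integral.
Local Open Scope ereal_scope.
Context (R : realType).
Local Notation mu := (@lebesgue_measure R).
Local Notation tR := (measurableTypeR R).

Lemma integral_lebesgue_tuple0 (f : 0.-tuple R -> \bar R) :
  measurable_fun setT f -> \int[lebesgue_tuple 0]_t f t = f [tuple].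
Proof.
move=> mf; transitivity (\int[\d_([tuple] : 0.-tuple R)]_t f t).
  exact: eq_measure_integral.
by rewrite integral_dirac// diracT mul1e.
Qed.

Lemma ge0_integral_lebesgue_tupleS n (f : n.+1.-tuple R -> \bar R) :
  measurable_fun setT f -> (forall t, 0 <= f t) ->
  \int[lebesgue_tuple n.+1]_t f t =
  \int[mu]_x \int[lebesgue_tuple n]_t f (cons_pair (x, t)).
Proof.
move=> mf f0; pose pm := (mu \x lebesgue_tuple n).
have mc := @measurable_cons_pair R n.
pose q : {measure set (n.+1.-tuple R) -> \bar R} :=
  measure_function_pushforward__canonical__measure_function_Measure pm mc.
transitivity (\int[q]_t f t); first exact: eq_measure_integral.
rewrite ge0_integral_pushforward// preimage_setT.
apply: (fubini_tonelli1 (f \o (@cons_pair R n) : tR * n.-tuple R -> \bar R)).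
  exact: measurableT_comp.
by move=> z; exact: f0.
Qed.

End lebesgue_tuple_integral.

Section stick.
Context (R : realType).
Local Notation mu := (@lebesgue_measure R).
Local Notation tR := (measurableTypeR R).
Implicit Types (a b : nat -> R) (m c : R).

(* The law of [m * rho] when rho is GD_{a,b}-distributed: break off a first
   piece x, which is m times a Beta(a_0, b_0) variable, and go on with the
   remaining length m - x. *)
Fixpoint stick_pdf n a b m : n.-tuple R -> R :=
  match n with
  | 0%N => fun=> 1
  | n'.+1 => fun t : n'.+1.-tuple R =>
     beta_kernel (a 0%N) (b 0%N) m (thead t) *
     stick_pdf n' (fun j => a j.+1) (fun j => b j.+1) (m - thead t)
       [tuple of behead t]
  end.

Lemma stick_pdf_cons n a b m x (t : n.-tuple R) :
  stick_pdf n.+1 a b m (cons_pair (x, t)) = beta_kernel (a 0%N) (b 0%N) m x *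
    stick_pdf n (fun j => a j.+1) (fun j => b j.+1) (m - x) t.
Proof.
by rewrite /= /cons_pair/= theadE; congr (_ * stick_pdf _ _ _ _ _); exact: val_inj.
Qed.

Lemma stick_pdf_ge0 n a b m (t : n.-tuple R) : 0 <= stick_pdf n a b m t.
Proof.
elim: n a b m t => [|n IH] a b m t //=.
by rewrite mulr_ge0 ?IH ?beta_kernel_ge0.
Qed.

Lemma measurable_stick_pdf n a b d (T : measurableType d) (f : T -> R)
    (g : T -> n.-tuple R) :
  measurable_fun setT f -> measurable_fun setT g ->
  measurable_fun setT (fun t => stick_pdf n a b (f t) (g t)).
Proof.
elim: n a b f g => [|n IH] a b f g mf mg /=; first exact: measurable_cst.
have mh : measurable_fun setT (fun t => thead (g t)).
  apply: (measurableT_comp (f := fun u : n.+1.-tuple R => tnth u ord0)) => //.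
  exact: measurable_tnth.
apply: measurable_funM; first exact: measurable_beta_kernel.
apply: IH; first exact: measurable_funB.
apply: (measurableT_comp (f := fun u : n.+1.-tuple R => [tuple of behead u])) => //.
exact: measurable_behead.
Qed.

Definition stick_int n a b m (F : n.-tuple R -> \bar R) : \bar R :=
  (\int[lebesgue_tuple n]_t ((stick_pdf n a b m t)%:E * F t))%E.

Lemma measurable_consl n x :
  measurable_fun setT (fun t : n.-tuple R => cons_pair (x, t)).
Proof.
exact: (measurable_fun_pair2 x (@measurable_cons_pair R n)).
Qed.

Section stick_int.
Local Open Scope ereal_scope.

Lemma stick_int_ge0 n a b m (F : n.-tuple R -> \bar R) :
  (forall t, 0 <= F t) -> 0 <= stick_int n a b m F.
Proof.
by move=> F0; apply: integral_ge0 => t _; rewrite mule_ge0 ?lee_fin ?stick_pdf_ge0.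
Qed.

Lemma stick_int0 a b m (F : 0.-tuple R -> \bar R) :
  measurable_fun setT F -> stick_int 0 a b m F = F [tuple].
Proof.
move=> mF; rewrite /stick_int.
under eq_integral do rewrite mul1e.
exact: integral_lebesgue_tuple0.
Qed.

(** Tonelli on the first coordinate: this is conditioning on the first piece, and it drives every
    induction on the number of pieces. *)
Lemma stick_intS n a b m (F : n.+1.-tuple R -> \bar R) :
  measurable_fun setT F -> (forall t, 0 <= F t) ->
  stick_int n.+1 a b m F =
  \int[mu]_x ((beta_kernel (a 0%N) (b 0%N) m x)%:E *
    stick_int n (fun j => a j.+1) (fun j => b j.+1) (m - x)
      (fun t => F (cons_pair (x, t)))).
Proof.
move=> mF F0; rewrite /stick_int ge0_integral_lebesgue_tupleS//; last 2 first.
- apply: emeasurable_funM => //; apply/measurable_EFinP.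
  exact: measurable_stick_pdf.
- by move=> t; rewrite mule_ge0 ?lee_fin ?stick_pdf_ge0.
apply: eq_integral => x _.
under eq_integral do rewrite stick_pdf_cons EFinM -muleA.
rewrite ge0_integralZl//.
- apply: emeasurable_funM.
    by apply/measurable_EFinP; exact: measurable_stick_pdf.
  by apply: measurableT_comp => //; exact: measurable_consl.
- by move=> t _; rewrite mule_ge0 ?lee_fin ?stick_pdf_ge0.
- by rewrite lee_fin beta_kernel_ge0.
Qed.

Lemma measurable_stick_int n a b m (F : n.+1.-tuple R -> \bar R) :
  measurable_fun setT F -> (forall t, 0 <= F t) ->
  measurable_fun setT (fun x : tR => stick_int n a b (m - x)
      (fun t => F (cons_pair (x, t)))).
Proof.
move=> mF F0.
pose f (z : tR * n.-tuple R) :=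
  (stick_pdf n a b (m - z.1) z.2)%:E * F (cons_pair z).
apply: (@measurable_fun_fubini_tonelli_F _ _ _ _ R (lebesgue_tuple n) f).
  apply: emeasurable_funM.
    apply/measurable_EFinP; apply: measurable_stick_pdf => //.
    exact: measurable_funB.
  by apply: measurableT_comp => //; exact: measurable_cons_pair.
by move=> z; rewrite mule_ge0 ?lee_fin ?stick_pdf_ge0.
Qed.

Lemma le_stick_int n a b m (F G : n.-tuple R -> \bar R) :
  measurable_fun setT F -> (forall t, 0 <= F t) ->
  measurable_fun setT G -> (forall t, F t <= G t) ->
  stick_int n a b m F <= stick_int n a b m G.
Proof.
move=> mF F0 mG FG.
have mD : measurable_fun setT (fun t => (stick_pdf n a b m t)%:E : \bar R).
  by apply/measurable_EFinP; exact: measurable_stick_pdf.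
apply: ge0_le_integral => //.
- by move=> t _; rewrite mule_ge0 ?lee_fin ?stick_pdf_ge0.
- exact: emeasurable_funM.
- exact: emeasurable_funM.
- by move=> t _; rewrite lee_wpmul2l// lee_fin stick_pdf_ge0.
Qed.

Lemma stick_int_cst n a b m (k : R) : (0 <= k)%R -> (0 < m)%R ->
  (forall j, (j < n)%N -> beta_norm (a j) (b j) != 0%R) ->
  stick_int n a b m (fun=> k%:E) = k%:E.
Proof.
elim: n a b m => [|n IH] a b m k0 m0 ab0; first by rewrite stick_int0.
rewrite stick_intS//.
transitivity (\int[mu]_x ((beta_kernel (a 0%N) (b 0%N) m x)%:E * k%:E)).
  (* For [x >= m] the kernel vanishes, so the induction hypothesis is used only with a positive
     remaining length. *)
  apply: eq_integral => x _; have [xm|xm] := ltP x m.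
    by rewrite IH// ?subr_gt0// => j jn; exact: ab0.
  by rewrite /beta_kernel (ppow_le0 R (b 0%N)) ?subr_le0// !mulr0 !mul0e.
rewrite ge0_integralZr//.
- by rewrite integral_beta_kernel ?mul1e// ab0.
- by apply/measurable_EFinP; exact: measurable_beta_kernel.
- by move=> x _; rewrite lee_fin beta_kernel_ge0.
Qed.

(** Stated for every real [m], because the remaining length [m n - x] may be negative for small [n].
    For [m <= 0] and at least one piece the kernel, hence the integral, is 0. *)
Lemma stick_int_le n a b m (k : R) (F : n.-tuple R -> \bar R) : (0 <= k)%R ->
  (forall j, (j < n)%N -> beta_norm (a j) (b j) != 0%R) ->
  measurable_fun setT F -> (forall t, 0 <= F t <= k%:E) ->
  stick_int n a b m F <= k%:E.
Proof.
move=> k0 ab0 mF F0k.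
have F0 t : 0 <= F t by have /andP[] := F0k t.
have Fk t : F t <= k%:E by have /andP[] := F0k t.
have [m0|m0] := ltP 0%R m.
  by rewrite -(stick_int_cst n a b m k)//; exact: le_stick_int.
case: n => [|n] in a b ab0 F mF F0k F0 Fk *; first by rewrite stick_int0.
rewrite stick_intS//.
by rewrite integral0_eq ?lee_fin// => x _; rewrite beta_kernel0// mul0e.
Qed.

Definition scale_tuple n c (t : n.-tuple R) : n.-tuple R :=
  [tuple c * tnth t i | i < n]%R.

Lemma measurable_scale_tuple n c : measurable_fun setT (@scale_tuple n c).
Proof.
apply/measurable_fun_tnthP => i.
rewrite (_ : _ \o _ = fun t => c * tnth t i)%R; last first.
  by apply/funext => t /=; rewrite tnth_mktuple.
by apply: measurable_funM => //; exact: measurable_tnth.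
Qed.

Lemma scale_tuple_cons n c x (t : n.-tuple R) :
  scale_tuple n.+1 c (cons_pair (x, t)) = cons_pair (c * x, scale_tuple n c t)%R.
Proof.
apply/eq_from_tnth => i; rewrite tnth_mktuple.
by case: (unliftP ord0 i) => [j|] ->; rewrite /cons_pair ?tnthS ?tnth_mktuple.
Qed.

(** Each piece scales by [beta_kernelM]. This moves the generalized Dirichlet law from the unit
    stick to a stick of length [N]. *)
Lemma stick_int_scale n a b m c (F : n.-tuple R -> \bar R) : (0 < c)%R ->
  measurable_fun setT F -> (forall t, 0 <= F t) ->
  stick_int n a b m (F \o scale_tuple n c) = stick_int n a b (c * m) F.
Proof.
elim: n a b m F => [|n IH] a b m F c0 mF F0.
  rewrite !stick_int0//=; last first.
    by apply: measurableT_comp => //; exact: measurable_scale_tuple.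
  by congr F; exact: tuple0.
rewrite [LHS]stick_intS; last 2 first.
- by apply: measurableT_comp => //; exact: measurable_scale_tuple.
- by move=> t; exact: F0.
apply: etrans (esym (stick_intS n a b (c * m) F mF F0)).
pose g (x : tR) : \bar R := (beta_kernel (a 0%N) (b 0%N) (c * m) x)%:E *
    stick_int n (fun j => a j.+1) (fun j => b j.+1) (c * m - x)
      (fun t => F (cons_pair (x, t))).
transitivity (c%:E * \int[mu]_x g (c * x)%R); last first.
  apply: ge0_integral_lebesgue_scale => //.
    apply: emeasurable_funM; last exact: measurable_stick_int.
    by apply/measurable_EFinP; exact: measurable_beta_kernel.
  by move=> x; rewrite mule_ge0 ?stick_int_ge0// lee_fin beta_kernel_ge0.
rewrite -ge0_integralZl//; last 3 first.
- apply: (measurableT_comp (f := g)); last exact: measurable_funM.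
  apply: emeasurable_funM; last exact: measurable_stick_int.
  by apply/measurable_EFinP; exact: measurable_beta_kernel.
- by move=> x _; rewrite mule_ge0 ?stick_int_ge0// lee_fin beta_kernel_ge0.
- by rewrite lee_fin ltW.
apply: eq_integral => x _; rewrite /g muleA -EFinM beta_kernelM// -mulrBr.
rewrite -IH//; last by apply: measurableT_comp => //; exact: measurable_consl.
congr (_ * stick_int _ _ _ _ _); apply/funext => t /=.
by rewrite scale_tuple_cons.
Qed.

End stick_int.

(* [b_{j-1}], with [c] in the role of the missing [b_{-1}]. *)
Let prevb c b j := if j is j'.+1 then b j' else c.

(** The free exponent [c] and the factor [m^(c-1)] are what the induction needs. Breaking off [x]
    leaves [(m - x)^(b_0 - 1)], which is this factor for the shorter stick with [c := b 0]. The
    power of [m] in the kernel combines with [m^(c-1)] into [m^(c - (a_0 + b_0))], the power in the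
    factor of index 0. *)
Lemma stick_pdfE n a b c m (t : n.-tuple R) : 0 < m ->
  m `^ (c - 1) * stick_pdf n a b m t =
  \1_([set x : n.-tuple R | (forall i, 0 < tnth x i) /\
     \sum_(i < n) tnth x i < m]) t *
  ((\prod_(j < n) beta_norm (a j) (b j))^-1 *
   (m - \sum_(i < n) tnth t i) `^ (prevb c b n - 1) *
   \prod_(j < n) (tnth t j `^ (a j - 1) *
     (m - \sum_(i < n | (i < j)%N) tnth t i) `^ (prevb c b j - (a j + b j)))).
Proof.
elim: n a b c m t => [|n IH] a b c m t m0.
  rewrite !big_ord0 mulr1 invr1 mul1r subr0 mulr1 indicE mem_set ?mul1r//.
  by split; [case|rewrite big_ord0].
have -> : t = cons_pair (thead t, [tuple of behead t]) by exact: tuple_eta.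
move: (thead t) [tuple of behead t] => x y {t}.
rewrite stick_pdf_cons.
(* Outside [0 < x < m] both sides vanish: the right one through the indicator, the left one through
   a cut-off of the kernel. *)
have [/andP[x0 xm]|xm] := boolP (0 < x < m); last first.
  rewrite indicE memNset ?mul0r; last first.
    move=> -[] /= pos; rewrite big_ord_recl/= => lem.
    have x0 := pos ord0.
    move/negP: xm; apply; rewrite [0 < _]x0/=.
    apply: le_lt_trans lem; rewrite lerDl sumr_ge0// => i _.
    exact/ltW/pos.
  rewrite /beta_kernel; move: xm; rewrite negb_and -!leNgt => /orP[x0|mx].
    by rewrite (ppow_le0 R _ x)// !(mul0r, mulr0).
  by rewrite (ppow_le0 R _ (m - x)) ?subr_le0// !(mul0r, mulr0).
have mx0 : 0 < m - x by rewrite subr_gt0.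
have := IH (fun j => a j.+1) (fun j => b j.+1) (b 0%N) (m - x) y mx0.
rewrite /beta_kernel !ppowE// => IHn.
rewrite [LHS](_ : _ = (beta_norm (a 0%N) (b 0%N))^-1 * x `^ (a 0%N - 1) *
  (m `^ (c - 1) * m `^ (1 - (a 0%N + b 0%N))) * ((m - x) `^ (b 0%N - 1) *
  stick_pdf n (fun j => a j.+1) (fun j => b j.+1) (m - x) y)); last by ring.
rewrite {}IHn -gt0_powRD// [X in m `^ X](_ : _ = c - (a 0%N + b 0%N)); last by ring.
have tS i : tnth (cons_pair (x, y)) (lift ord0 i) = tnth y i.
  by rewrite /cons_pair tnthS.
have Es : \sum_(i < n.+1) tnth (cons_pair (x, y)) i = x + \sum_(i < n) tnth y i.
  by rewrite big_ord_recl; congr (_ + _); apply: eq_bigr => i _; rewrite tS.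
have Ei : \1_([set z : n.+1.-tuple R | (forall i, 0 < tnth z i) /\
    \sum_(i < n.+1) tnth z i < m]) (cons_pair (x, y)) =
    \1_([set z : n.-tuple R | (forall i, 0 < tnth z i) /\
    \sum_(i < n) tnth z i < m - x]) y :> R.
  rewrite !indicE; congr (nat_of_bool _)%:R; apply/idP/idP.
    rewrite !inE /= Es => -[pos lem]; split; last by rewrite ltrBrDl.
    by move=> i; rewrite -tS.
  rewrite !inE /= Es => -[pos lem]; split; last by rewrite -ltrBrDl.
  by move=> i; case: (unliftP ord0 i) => [k|] ->; rewrite ?tS.
have Ep : \prod_(j < n.+1) (tnth (cons_pair (x, y)) j `^ (a j - 1) *
     (m - \sum_(i < n.+1 | (i < j)%N) tnth (cons_pair (x, y)) i)
       `^ (prevb c b j - (a j + b j))) =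
  x `^ (a 0%N - 1) * m `^ (c - (a 0%N + b 0%N)) *
  \prod_(j < n) (tnth y j `^ (a j.+1 - 1) *
     (m - x - \sum_(i < n | (i < j)%N) tnth y i)
       `^ (prevb (b 0%N) (fun j => b j.+1) j - (a j.+1 + b j.+1))).
  rewrite big_ord_recl big_pred0// subr0; congr (_ * _).
  apply: eq_bigr => j _; rewrite tS lift0; congr (_ * (_ `^ _)).
    rewrite big_mkcond big_ord_recl/= -addrA -opprD; congr (_ - (_ + _)).
    by rewrite [RHS]big_mkcond; apply: eq_bigr => i _; rewrite tS.
  by case: (nat_of_ord j).
have -> : prevb (b 0%N) (fun j => b j.+1) n = prevb c b n.+1 by case: (n).
have -> : \prod_(j < n.+1) beta_norm (a j) (b j) =
    beta_norm (a 0%N) (b 0%N) * \prod_(j < n) beta_norm (a j.+1) (b j.+1).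
  by rewrite big_ord_recl.
rewrite Ei Es Ep (invfM (beta_norm _ _)) (opprD x) (addrA m).
move: (beta_norm _ _)^-1 => u.
ring.
Qed.

End stick.
Arguments stick_pdf {R}.
Arguments stick_int {R}.

(** The case [m = c = 1] of [stick_pdfE], whose prefactor is 1. The two conventions for the missing
    exponent at index 0 agree because the base there is 1. *)
Lemma gd_pdf_stick (R : realType) n (a b : nat -> R) (t : n.-tuple R) :
  gd_pdf a b t = stick_pdf n a b 1 t.
Proof.
transitivity (1 `^ (1 - 1) * stick_pdf n a b 1 t); last by rewrite powR1 mul1r.
rewrite stick_pdfE// /gd_pdf /gd_norm.
congr (_ * (_ * _ * _)).
  by case: n t => [|n] t //=; rewrite big_ord0 subr0 !powR1.
apply: eq_bigr => -[[|j] jn] _ //=.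
by rewrite big_pred0// subr0 !powR1.
Qed.

(** * Convergence of Beta to Gamma *)

Set Implicit Arguments.
Unset Strict Implicit.

Section beta_to_gamma.
Context (R : realType).
Local Notation mu := (@lebesgue_measure R).
Local Notation tR := (measurableTypeR R).

Lemma integral_ppow_expR (a c : R) : 0 < c -> Gamma_fun a != 0 ->
  (\int[mu]_x (ppow a x * expR (- (c * x)))%:E = (c `^ (- a) * Gamma_fun a)%:E)%E.
Proof.
move=> c0 Ga; have := egamma_fin R a Ga.
pose f (x : tR) : \bar R := (ppow a x * expR (- x))%:E.
rewrite /egamma -[LHS]/(\int[mu]_x f x)%E.
rewrite -(ge0_integral_lebesgue_scale R c f c0); last 2 first.
- exact: measurable_ppow_expRN.
- by move=> x; rewrite lee_fin mulr_ge0 ?ppow_ge0 ?expR_ge0.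
have fE x : f (c * x) = ((c `^ (a - 1))%:E * (ppow a x * expR (- (c * x)))%:E)%E.
  by rewrite /f ppowM// -EFinM mulrA.
under eq_integral do rewrite fE.
rewrite ge0_integralZl//; last 3 first.
- exact: measurable_ppow_expR.
- by move=> x _; rewrite lee_fin mulr_ge0 ?ppow_ge0 ?expR_ge0.
- by rewrite lee_fin powR_ge0.
move=> /(congr1 (fun y => (c `^ (- a))%:E * y))%E.
rewrite !muleA -!EFinM => <-.
rewrite -[X in _ * X * _]powRr1 ?ltW// -!gt0_powRD//.
by rewrite [X in c `^ X](_ : _ = 0) ?powRr0 ?mul1e//; ring.
Qed.

(** Both bounds are [ln (1 + u) <= u]: with [u = -t], and with [u = t / (1 - t)] after taking the
    inverse [(1 - t)^-1 = 1 + u]. *)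
Lemma ln_onem_bounds (t : R) : t < 1 -> - (t / (1 - t)) <= ln (1 - t) <= - t.
Proof.
move=> t1; have t0 : 0 < 1 - t by rewrite subr_gt0.
apply/andP; split; last by apply: le_ln1Dx; rewrite ltrN2.
rewrite lerNl -lnV ?posrE//.
have tE : (1 - t)^-1 = 1 + t / (1 - t) by field; rewrite gt_eqF.
rewrite [X in ln X]tE; apply: le_ln1Dx.
by rewrite -subr_gt0 opprK addrC -tE invr_gt0.
Qed.

Section one_dim.
Variables (a q c : R) (b m : nat -> R).
Hypotheses (q0 : 0 < q) (c0 : 0 < c).
Hypothesis m0 : forall n, 0 < m n.
Hypothesis my : m n @[n --> \oo] --> +oo.
Hypothesis bmc : forall n, c <= (b n - 1) / m n.
Hypothesis bmq : (b n - 1) / m n @[n --> \oo] --> q.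

(** The part of the Beta kernel that depends on [x]. The constant in front is split off and its
    limit is found separately. *)
Definition beta_limit_fun n x : R :=
  ppow a x * (if x < m n then (1 - x / m n) `^ (b n - 1) else 0).

Let b1 n : 0 < b n - 1.
Proof.
have := lt_le_trans c0 (bmc n); rewrite ltr_pdivlMr ?mul0r//.
Qed.

(** The exponent is written as the rate [(b n - 1) / m n], which tends to [q], times
    [m n * ln (1 - x / m n)], which tends to [- x]. *)
Let powE n x : x < m n ->
  (1 - x / m n) `^ (b n - 1) =
  expR ((b n - 1) / m n * (m n * ln (1 - x / m n))).
Proof.
move=> xm; rewrite /powR gt_eqF; last by rewrite subr_gt0 ltr_pdivrMr ?mul1r.
by congr expR; field; rewrite gt_eqF.
Qed.

(** [ln_onem_bounds] squeezes the power between two exponentials with the same limit. *)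
Lemma cvg_beta_limit_fun x :
  beta_limit_fun n x @[n --> \oo] --> ppow a x * expR (- (q * x)).
Proof.
apply: cvgM; first exact: cvg_cst.
have mV : (m n)^-1 @[n --> \oo] --> 0.
  by apply/(gtr0_cvgV0 _).2 => //; apply: nearW.
have xm : x / m n @[n --> \oo] --> 0.
  by rewrite -(mulr0 x); apply: cvgM => //; exact: cvg_cst.
have up : expR (- ((b n - 1) / m n * x)) @[n --> \oo] --> expR (- (q * x)).
  apply: continuous_cvg; first exact: continuous_expR.
  by apply: cvgN; apply: cvgM => //; exact: cvg_cst.
have low : expR (- ((b n - 1) / m n * x / (1 - x / m n))) @[n --> \oo] -->
    expR (- (q * x)).
  apply: continuous_cvg; first exact: continuous_expR.
  rewrite -[q * x]divr1; apply: cvgN; apply: cvgM.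
    by apply: cvgM => //; exact: cvg_cst.
  apply: cvgV => //; rewrite -[X in _ --> X]subr0.
  by apply: cvgB => //; exact: cvg_cst.
apply: (squeeze_cvgr _ low up); near=> n.
have xmn : x < m n by near: n; exact: (cvgryPgt _).1.
have xm1 : x / m n < 1 by rewrite ltr_pdivrMr ?mul1r.
have /andP[lo hi] := ln_onem_bounds xm1.
have bm0 : 0 < (b n - 1) / m n by rewrite divr_gt0.
rewrite xmn powE// !ler_expR; apply/andP; split.
  rewrite -mulrA -mulrN ler_pM2l//.
  rewrite (_ : - (x / (1 - x / m n)) = m n * - (x / m n / (1 - x / m n))); last first.
    by field; rewrite !gt_eqF// subr_gt0.
  by rewrite ler_pM2l.
rewrite -[leRHS]mulrN ler_pM2l// (_ : - x = m n * - (x / m n)); last first.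
  by field; rewrite gt_eqF.
by rewrite ler_pM2l.
Unshelve. all: by end_near. Qed.

Lemma beta_limit_fun_ge0 n x : 0 <= beta_limit_fun n x.
Proof.
by rewrite mulr_ge0 ?ppow_ge0//; case: ifP => // _; exact: powR_ge0.
Qed.

(** [ln (1 - t) <= -t] and the uniform lower bound [c] on the rates give a majorant independent of
    [n]; it is integrable because the Gamma value is finite. *)
Lemma beta_limit_fun_le n x : beta_limit_fun n x <= ppow a x * expR (- (c * x)).
Proof.
rewrite /beta_limit_fun; have [x0|x0] := leP x 0.
  by rewrite ppow_le0// !mul0r.
apply: ler_wpM2l; first exact: ppow_ge0.
case: ifPn => [xm|_]; last exact: expR_ge0.
have xm1 : x / m n < 1 by rewrite ltr_pdivrMr ?mul1r.
have /andP[_ hi] := ln_onem_bounds xm1.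
rewrite powE// ler_expR.
have bm0 : 0 < (b n - 1) / m n by rewrite divr_gt0.
apply: (@le_trans _ _ ((b n - 1) / m n * - x)).
  rewrite ler_pM2l// (_ : - x = m n * - (x / m n)); last first.
    by field; rewrite gt_eqF.
  by rewrite ler_pM2l.
by rewrite mulrN lerN2 ler_pM2r.
Qed.

Lemma measurable_beta_limit_fun n : measurable_fun setT (beta_limit_fun n : tR -> R).
Proof.
apply: measurable_funM; first exact: measurable_ppow.
apply: measurable_fun_ifT => //; first exact: measurable_fun_ltr.
apply: (measurableT_comp (measurable_powR _)).
by apply: measurable_funB => //; exact: measurable_funM.
Qed.

(** Factoring [m] out of [m - x] leaves the exponent [1 - (a + b) + (b - 1) = - a]. *)
Lemma beta_kernel_limit_fun n x : beta_kernel a (b n) (m n) x =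
  (beta_norm a (b n))^-1 * (m n) `^ (- a) * beta_limit_fun n x.
Proof.
rewrite /beta_kernel /beta_limit_fun; set v := if _ then _ else _.
suff E : m n `^ (1 - (a + b n)) * ppow (b n) (m n - x) = m n `^ (- a) * v.
  by rewrite mulrCA -!mulrA E; ring.
rewrite {}/v; case: ifPn => xm; last first.
  by rewrite (ppow_le0 R (b n)) ?mulr0// subr_le0 leNgt.
rewrite ppowE ?subr_gt0// [X in X `^ (b n - 1)](_ : _ = m n * (1 - x / m n)).
  rewrite powRM; last 2 first.
  - exact: ltW.
  - by rewrite subr_ge0 ler_pdivrMr ?mul1r// ltW.
  rewrite mulrA -gt0_powRD//; congr (_ `^ _ * _); ring.
by field; rewrite gt_eqF.
Qed.

Section bounded_test_functions.
Local Open Scope ereal_scope.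
Hypothesis Ga : Gamma_fun a != 0%R.
Variables (h_ : nat -> tR -> \bar R) (h : tR -> \bar R) (M : R).
Hypothesis mh_ : forall n, measurable_fun setT (h_ n).
Hypothesis h_ge0 : forall n x, 0 <= h_ n x.
Hypothesis h_le : forall n x, h_ n x <= M%:E.
Hypothesis h_h : forall x, h_ n x @[n --> \oo] --> h x.

Let h_fin x : h x \is a fin_num.
Proof.
have h0 : 0 <= h x by apply: (cvge_ge _ (@h_h x)); exact: nearW.
have hM : h x <= M%:E by apply: (cvge_le _ (@h_h x)); exact: nearW.
by rewrite ge0_fin_numE// (le_lt_trans hM)// ltry.
Qed.

Let M0 : (0 <= M)%R.
Proof. by rewrite -lee_fin (le_trans (h_ge0 0%N 0%R)). Qed.

(** Dominated convergence. The test functions depend on [n] because in the induction they are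
    integrals over the later pieces. Finiteness of the limit is recorded since products of extended
    reals pass to the limit only when defined. *)
Lemma cvg_integral_beta_limit_fun :
  (\int[mu]_x ((ppow a x * expR (- (q * x)))%:E * h x)) \is a fin_num /\
  \int[mu]_x ((beta_limit_fun n x)%:E * h_ n x) @[n --> \oo] -->
  \int[mu]_x ((ppow a x * expR (- (q * x)))%:E * h x).
Proof.
pose g (x : tR) := (ppow a x * expR (- (c * x)))%:E * M%:E.
have mg : measurable_fun setT (fun x : tR => (ppow a x * expR (- (c * x)))%:E).
  exact: measurable_ppow_expR.
have ig : mu.-integrable setT g.
  apply/integrableP; split; first exact: emeasurable_funM.
  rewrite (eq_integral g); last first.
    move=> x _; rewrite gee0_abs// mule_ge0 ?lee_fin//.
    by rewrite mulr_ge0 ?ppow_ge0 ?expR_ge0.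
  rewrite ge0_integralZr//; last first.
    by move=> x _; rewrite lee_fin mulr_ge0 ?ppow_ge0 ?expR_ge0.
  by rewrite integral_ppow_expR// -EFinM ltry.
have mf n : measurable_fun setT (fun x : tR => (beta_limit_fun n x)%:E * h_ n x).
  apply: emeasurable_funM => //; apply/measurable_EFinP.
  exact: measurable_beta_limit_fun.
have cf x : (beta_limit_fun n x)%:E * h_ n x @[n --> \oo] -->
    (ppow a x * expR (- (q * x)))%:E * h x.
  apply: cvgeM; last exact: h_h.
    by apply: mule_def_fin.
  by apply: cvg_EFin; [exact: nearW|exact: cvg_beta_limit_fun].
have [] := @dominated_convergence _ _ _ mu setT measurableT
  (fun n (x : tR) => (beta_limit_fun n x)%:E * h_ n x)
  (fun x : tR => (ppow a x * expR (- (q * x)))%:E * h x) g mf _ _ ig _ =>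
  [|||/integrable_fin_num fin _ cvg]; last by split=> //; exact: fin.
- apply: (emeasurable_fun_cvg _ _ mf) => x _; exact: cf.
- by apply: aeW => x _.
- apply: aeW => x n _; rewrite gee0_abs ?mule_ge0 ?lee_fin ?beta_limit_fun_ge0//.
  apply: lee_pmul => //; first by rewrite lee_fin beta_limit_fun_ge0.
  by rewrite lee_fin beta_limit_fun_le.
Qed.

End bounded_test_functions.

Section beta_kernel.
Local Open Scope ereal_scope.
Hypothesis Ga : Gamma_fun a != 0%R.
Hypothesis ab : forall n, beta_norm a (b n) != 0%R.

Let K n : R := ((beta_norm a (b n))^-1 * (m n) `^ (- a))%R.

Let K_ge0 n : (0 <= K n)%R.
Proof. by rewrite mulr_ge0 ?invr_ge0 ?beta_norm_ge0 ?powR_ge0. Qed.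

Let integral_kernelE n (f : tR -> \bar R) :
  measurable_fun setT f -> (forall x, 0 <= f x) ->
  \int[mu]_x ((beta_kernel a (b n) (m n) x)%:E * f x) =
  (K n)%:E * \int[mu]_x ((beta_limit_fun n x)%:E * f x).
Proof.
move=> mf f0; rewrite -ge0_integralZl//.
- by apply: eq_integral => x _; rewrite muleA -EFinM beta_kernel_limit_fun.
- apply: emeasurable_funM => //; apply/measurable_EFinP.
  exact: measurable_beta_limit_fun.
- by move=> x _; rewrite mule_ge0 ?lee_fin ?beta_limit_fun_ge0.
- by rewrite lee_fin.
Qed.

(* The normalizing constants converge because the total masses do: this is
   Gamma(a + b) / Gamma(b) ~ b^a. *)
Let cvg_K : K n @[n --> \oo] --> (q `^ a / Gamma_fun a)%R.
Proof.
pose U n := \int[mu]_x (beta_limit_fun n x)%:E.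
have KU n : (K n)%:E * U n = 1.
  rewrite -(integral_beta_kernel R a (b n) (m n) (ab n) (m0 n)).
  have := @integral_kernelE n (cst 1) (measurable_cst _) (fun=> lee01).
  under eq_integral do rewrite mule1.
  by under [in X in _ = X]eq_integral do rewrite mule1.
have cU : U n @[n --> \oo] --> (q `^ (- a) * Gamma_fun a)%:E.
  rewrite -integral_ppow_expR//.
  have [_] := @cvg_integral_beta_limit_fun Ga (fun=> cst 1) (cst 1) 1%R
    (fun=> measurable_cst _) (fun _ _ => lee01) (fun _ _ => lexx _)
    (fun x => cvg_cst _).
  under eq_integral do rewrite mule1.
  by under eq_fun do under eq_integral do rewrite mule1.
have L0 : (q `^ (- a) * Gamma_fun a != 0)%R by rewrite mulf_neq0// gt_eqF// powR_gt0.
(* A priori [U n] might be infinite; a product with a nonnegative real would then be 0 or infinite,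
   never 1. *)
have KE n : K n = ((fine (U n))^-1)%R.
  have := KU n; case: (U n) => [u| |].
  - rewrite -EFinM => -[Ku]; have u0 : u != 0%R.
      by apply/eqP => u0; move: Ku; rewrite u0 mulr0 => /eqP; rewrite eq_sym oner_eq0.
    by apply: (mulIf u0); rewrite Ku mulVf.
  - have := K_ge0 n; rewrite le_eqVlt => /predU1P[<-|K1]; last by rewrite gt0_muley.
    by rewrite mul0e => -[] /eqP; rewrite eq_sym oner_eq0.
  - have := K_ge0 n; rewrite le_eqVlt => /predU1P[<-|K1]; last by rewrite gt0_muleNy.
    by rewrite mul0e => -[] /eqP; rewrite eq_sym oner_eq0.
rewrite (_ : q `^ a / _ = (q `^ (- a) * Gamma_fun a)^-1)%R; last first.
  by rewrite invfM -powRN opprK.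
under eq_fun do rewrite KE.
by apply: cvgV => //; exact: fine_cvg.
Qed.

Lemma gamma_pdfE x : gamma_pdf a q x =
  (q `^ a / Gamma_fun a * (ppow a x * expR (- (q * x))))%R.
Proof.
rewrite /gamma_pdf /ppow; case: ifPn => _; first by rewrite !mulrA.
by rewrite mul0r mulr0.
Qed.

Lemma cvg_integral_beta_kernel (h_ : nat -> tR -> \bar R) (h : tR -> \bar R)
    (M : R) :
  (forall n, measurable_fun setT (h_ n)) ->
  (forall n x, 0 <= h_ n x) -> (forall n x, h_ n x <= M%:E) ->
  (forall x, h_ n x @[n --> \oo] --> h x) ->
  \int[mu]_x ((beta_kernel a (b n) (m n) x)%:E * h_ n x) @[n --> \oo] -->
  \int[mu]_x ((gamma_pdf a q x)%:E * h x).
Proof.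
move=> mh h0 hM hh.
have h_ge0 x : 0 <= h x by apply: (cvge_ge _ (@hh x)); exact: nearW.
have mhl : measurable_fun setT h.
  by apply: (emeasurable_fun_cvg _ _ mh) => x _; exact: hh.
have [fin c1] := @cvg_integral_beta_limit_fun Ga h_ h M mh h0 hM hh.
under eq_fun do rewrite integral_kernelE//.
have -> : \int[mu]_x ((gamma_pdf a q x)%:E * h x) = (q `^ a / Gamma_fun a)%:E *
    \int[mu]_x ((ppow a x * expR (- (q * x)))%:E * h x).
  rewrite -ge0_integralZl//.
  - by apply: eq_integral => x _; rewrite muleA -EFinM gamma_pdfE.
  - by apply: emeasurable_funM => //; exact: measurable_ppow_expR.
  - by move=> x _; rewrite mule_ge0 ?lee_fin ?mulr_ge0 ?ppow_ge0 ?expR_ge0.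
  - by rewrite lee_fin divr_ge0 ?powR_ge0// ltW// Gamma_fun_gt0.
apply: cvgeM => //; last by apply: cvg_EFin; [exact: nearW|exact: cvg_K].
exact: mule_def_fin.
Qed.

End beta_kernel.

End one_dim.
End beta_to_gamma.

(** * The limit of the first [k] pieces of a long stick *)

Section stick_limit.
Context (R : realType) (p : R).
Hypothesis p0 : 0 < p.
Local Notation mu := (@lebesgue_measure R).
Local Notation tR := (measurableTypeR R).

Lemma cvg_beta_to_gamma (a : R) (b m : nat -> R)
    (h_ : nat -> tR -> \bar R) (h : tR -> \bar R) (M : R) :
  Gamma_fun a != 0 -> (forall n, beta_norm a (b n) != 0) ->
  m n @[n --> \oo] --> +oo ->
  p * b n / m n @[n --> \oo] --> (1 : R) ->
  (forall n, measurable_fun setT (h_ n)) ->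
  (forall n x, 0 <= h_ n x)%E -> (forall n x, h_ n x <= M%:E)%E ->
  (forall x, h_ n x @[n --> \oo] --> h x) ->
  (\int[mu]_x ((beta_kernel a (b n) (m n) x)%:E * h_ n x))%E @[n --> \oo] -->
  (\int[mu]_x ((gamma_pdf a p^-1 x)%:E * h x))%E.
Proof.
move=> Ga ab my bm mh h0 hM hh.
have pV0 : 0 < p^-1 by rewrite invr_gt0.
have m0 : \forall n \near \oo, 0 < m n by exact: (cvgryPgt _).1.
have mV : (m n)^-1 @[n --> \oo] --> (0 : R).
  exact/(gtr0_cvgV0 m0).2.
have bm1 : (b n - 1) / m n @[n --> \oo] --> p^-1.
  rewrite (_ : (fun n => _) = (fun n => p^-1 * (p * b n / m n) - (m n)^-1)).
    rewrite -[X in _ --> X]subr0; apply: cvgB => //.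
    by rewrite -[X in _ --> X]mulr1; apply: cvgM => //; exact: cvg_cst.
  by apply/funext => n; rewrite mulrBl mul1r !mulrA mulVf ?mul1r// gt_eqF.
(* Any positive constant below the limit [p^-1] of the rates could be the decay rate of the
   majorant; half of it is taken. *)
have [N _ HN] : \forall n \near \oo, 0 < m n /\ p^-1 / 2 <= (b n - 1) / m n.
  near=> n; split; near: n => //.
  by apply: (cvgr_ge _ bm1); rewrite ltr_pdivrMr// ltr_pMr// ltr1n.
(* Positivity of the lengths and the lower bound on the rates hold only eventually, so the sequences
   are restarted at [N]. *)
rewrite -(cvg_shiftn N).
apply: (@cvg_integral_beta_kernel R a p^-1 (p^-1 / 2) (fun n => b (n + N)%N)
  (fun n => m (n + N)%N) pV0 _ _ _ _ _ Ga _ (fun n => h_ (n + N)%N) h M) => //.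
- by rewrite divr_gt0.
- by move=> n; have [] := HN _ (leq_addl n N).
- by rewrite (cvg_shiftn N m).
- by move=> n; have [] := HN _ (leq_addl n N).
- by rewrite (cvg_shiftn N (fun n => (b n - 1) / m n)).
- by move=> x; rewrite (cvg_shiftn N (h_ ^~ x)).
Unshelve. all: by end_near. Qed.

Lemma cvg_ratio_shift (m u : nat -> R) (x l : R) : m n @[n --> \oo] --> +oo ->
  u n / m n @[n --> \oo] --> l -> u n / (m n - x) @[n --> \oo] --> l.
Proof.
move=> my um.
have m0 : \forall n \near \oo, 0 < m n by exact: (cvgryPgt _).1.
have mV : (m n)^-1 @[n --> \oo] --> (0 : R) by exact/(gtr0_cvgV0 m0).2.
have um' : u n / m n / (1 - x * (m n)^-1) @[n --> \oo] --> l.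
  rewrite -[X in _ --> X]divr1; apply: cvgM => //; apply: cvgV => //.
  rewrite -[X in _ --> X]subr0; apply: cvgB; first exact: cvg_cst.
  by rewrite -[X in _ --> X](mulr0 x); apply: cvgM => //; exact: cvg_cst.
apply: (cvg_trans _ um'); apply: near_eq_cvg; near=> n.
have mn : 0 < m n by near: n.
have mx : x < m n by near: n; exact: (cvgryPgt _).1.
by field; rewrite !gt_eqF ?subr_gt0.
Unshelve. all: by end_near. Qed.

Lemma cvg_pinfty_shift (m : nat -> R) (x : R) : m n @[n --> \oo] --> +oo ->
  m n - x @[n --> \oo] --> +oo.
Proof.
move=> /cvgryPge my; apply/cvgryPge => A.
by apply: filterS (my (A + x)) => n; rewrite lerBrDr.
Qed.

(** Using [nth] with a default keeps proofs of [k <= n] out of the term, so that it commutes with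
    [cons_pair] in the induction. *)
Definition first_coords k n (t : n.-tuple R) : k.-tuple R :=
  [tuple nth 0 t j | j < k].

Lemma first_coordsS k n x (t : n.-tuple R) :
  first_coords k.+1 (cons_pair (x, t)) = cons_pair (x, first_coords k t).
Proof.
apply/eq_from_tnth => i; rewrite tnth_mktuple.
by case: (unliftP ord0 i) => [j|] ->; rewrite /cons_pair ?tnthS ?tnth_mktuple.
Qed.

Lemma measurable_first_coords k n :
  measurable_fun setT (@first_coords k n).
Proof.
apply/measurable_fun_tnthP => i.
rewrite (_ : _ \o _ = fun t : n.-tuple R => nth 0 t i); last first.
  by apply/funext => t /=; rewrite tnth_mktuple.
have [ilt|nle] := ltnP i n; last first.
  rewrite (_ : (fun _ => _) = cst 0)//; apply/funext => t.
  by rewrite nth_default// size_tuple.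
rewrite (_ : (fun _ => _) = fun t : n.-tuple R => tnth t (Ordinal ilt)).
  exact: measurable_tnth.
by apply/funext => t; rewrite (tnth_nth 0).
Qed.

Lemma measurable_gamma_pdf (a q : R) d (T : measurableType d) (f : T -> R) :
  measurable_fun setT f -> measurable_fun setT (fun t => gamma_pdf a q (f t)).
Proof.
move=> mf; under eq_fun do rewrite gamma_pdfE.
apply: measurable_funM => //; apply: measurable_funM; first exact: measurable_ppow.
by apply: measurableT_comp => //; apply: measurableT_comp => //; exact: measurable_funM.
Qed.

Definition gamma_prod_pdf k (al : nat -> R) (t : k.-tuple R) : R :=
  \prod_(j < k) gamma_pdf (al j) p^-1 (tnth t j).

Lemma gamma_pdf_ge0 (a q x : R) : 0 <= gamma_pdf a q x.
Proof.
have G0 : 0 <= Gamma_fun a by rewrite Gamma_funE fine_ge0// egamma_ge0.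
rewrite /gamma_pdf; case: ifP => // _.
by rewrite !mulr_ge0 ?invr_ge0 ?powR_ge0 ?expR_ge0.
Qed.

Lemma gamma_prod_pdf_ge0 k al (t : k.-tuple R) : 0 <= gamma_prod_pdf al t.
Proof. by apply: prodr_ge0 => j _; exact: gamma_pdf_ge0. Qed.

Lemma gamma_prod_pdfS k al x (t : k.-tuple R) :
  gamma_prod_pdf al (cons_pair (x, t)) =
  gamma_pdf (al 0%N) p^-1 x * gamma_prod_pdf (fun j => al j.+1) t.
Proof.
rewrite /gamma_prod_pdf big_ord_recl; congr (_ * _).
by apply: eq_bigr => i _; rewrite /cons_pair tnthS lift0.
Qed.

Lemma measurable_gamma_prod_pdf k al :
  measurable_fun setT (@gamma_prod_pdf k al).
Proof.
by apply: measurable_prod => i _; apply: measurable_gamma_pdf; exact: measurable_tnth.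
Qed.

Local Open Scope ereal_scope.

Lemma integral_gamma_prod_pdfS k al (F : k.+1.-tuple R -> \bar R) :
  measurable_fun setT F -> (forall t, 0 <= F t) ->
  \int[lebesgue_tuple k.+1]_t ((gamma_prod_pdf al t)%:E * F t) =
  \int[mu]_x ((gamma_pdf (al 0%N) p^-1 x)%:E *
    \int[lebesgue_tuple k]_t ((gamma_prod_pdf (fun j => al j.+1) t)%:E *
      F (cons_pair (x, t)))).
Proof.
move=> mF F0; rewrite ge0_integral_lebesgue_tupleS//; last 2 first.
- apply: emeasurable_funM => //; apply/measurable_EFinP.
  exact: measurable_gamma_prod_pdf.
- by move=> t; rewrite mule_ge0 ?lee_fin ?gamma_prod_pdf_ge0.
apply: eq_integral => x _.
under eq_integral do rewrite gamma_prod_pdfS EFinM -muleA.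
rewrite ge0_integralZl//.
- apply: emeasurable_funM.
    by apply/measurable_EFinP; exact: measurable_gamma_prod_pdf.
  by apply: measurableT_comp => //; exact: measurable_consl.
- by move=> t _; rewrite mule_ge0 ?lee_fin ?gamma_prod_pdf_ge0.
- by rewrite lee_fin gamma_pdf_ge0.
Qed.

(** Once [x] is fixed, [m] becomes [m - x], [F] becomes its section at [x] and the parameters are
    shifted, so [m] has to be arbitrary. The number [r n] of leftover pieces is free as well: they
    integrate to 1 in the base case. *)
Lemma cvg_stick_int k (r : nat -> nat) (al : nat -> R) (a b : nat -> nat -> R)
    (m : nat -> R) (M : R) (F : k.-tuple R -> \bar R) :
  (forall j, (j < k)%N -> Gamma_fun (al j) != 0%R) ->
  (forall n j, (j < k)%N -> a n j = al j) ->
  (forall n j, (j < k + r n)%N -> beta_norm (a n j) (b n j) != 0%R) ->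
  m n @[n --> \oo] --> +oo%R ->
  (forall j, (j < k)%N -> (p * b n j / m n)%R @[n --> \oo] --> (1 : R)%R) ->
  measurable_fun setT F -> (forall t, 0 <= F t) -> (forall t, F t <= M%:E) ->
  stick_int (k + r n) (a n) (b n) (m n) (F \o @first_coords k (k + r n))
    @[n --> \oo] -->
  \int[lebesgue_tuple k]_t ((gamma_prod_pdf al t)%:E * F t).
Proof.
elim: k al a b m F => [|k IH] al a b m F Gal aal ab my bm mF F0 FM.
  rewrite integral_lebesgue_tuple0; last first.
    apply: emeasurable_funM => //; apply/measurable_EFinP.
    exact: measurable_gamma_prod_pdf.
  rewrite /gamma_prod_pdf big_ord0 mul1e.
  (* With no coordinate left the integrand is a constant, and the total mass is 1 as soon as [m n]
     is positive. *)
  apply: cvg_near_cst; near=> n.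
  have mn : (0 < m n)%R by near: n; exact: (cvgryPgt _).1.
  have FE : F [tuple] = (fine (F [tuple]))%:E.
    by rewrite fineK// ge0_fin_numE// (le_lt_trans (FM _))// ltry.
  rewrite [RHS]FE -(@stick_int_cst R (0 + r n) (a n) (b n) (m n))//.
  - congr (stick_int _ _ _ _ _); apply/funext => t /=.
    by rewrite -FE; congr F; exact: tuple0.
  - by rewrite fine_ge0.
  - by move=> j jn; exact: ab.
rewrite integral_gamma_prod_pdfS//.
have mFx x : measurable_fun setT (fun t : k.-tuple R => F (cons_pair (x, t))).
  by apply: measurableT_comp => //; exact: measurable_consl.
(* The conditional expectation given a first piece [x]. The induction hypothesis yields its limit
   for each fixed [x]; the bound [M] replaces uniformity in [x]. *)
pose h_ n (x : tR) := stick_int (k + r n) (fun j => a n j.+1)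
   (fun j => b n j.+1) (m n - x) (fun t => F (first_coords k.+1 (cons_pair (x, t)))).
have h_E n x : h_ n x = stick_int (k + r n) (fun j => a n j.+1)
   (fun j => b n j.+1) (m n - x)
   ((fun t => F (cons_pair (x, t))) \o @first_coords k (k + r n)).
  congr (stick_int _ _ _ _ _); apply/funext => t /=.
  by rewrite first_coordsS.
have mFk n : measurable_fun setT (F \o @first_coords k.+1 n).
  by apply: measurableT_comp => //; exact: measurable_first_coords.
have SE n : stick_int (k.+1 + r n) (a n) (b n) (m n)
   (F \o @first_coords k.+1 (k.+1 + r n)) =
   \int[mu]_x ((beta_kernel (al 0%N) (b n 0%N) (m n) x)%:E * h_ n x).
  rewrite -(aal n)//; apply: (@stick_intS R (k + r n)) => //.
  by move=> t /=; exact: F0.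
under eq_fun do rewrite SE.
have M0 : (0 <= M)%R.
  by rewrite -lee_fin (le_trans (F0 [tuple of nseq k.+1 0%R])).
apply: (@cvg_beta_to_gamma (al 0%N) (fun n => b n 0%N) m h_ _ M) => //.
- exact: Gal.
- by move=> n; rewrite -(aal n)//; exact: ab.
- exact: bm.
- move=> n; apply: (@measurable_stick_int R (k + r n) (fun j => a n j.+1)
    (fun j => b n j.+1) (m n) (F \o @first_coords k.+1 (k + r n).+1)) => //.
  by move=> t /=; exact: F0.
- move=> n x; apply: stick_int_ge0 => t; exact: F0.
- move=> n x; rewrite h_E; apply: stick_int_le => //.
  + by move=> j jn; exact: ab.
  + by apply: measurableT_comp; [exact: mFx|exact: measurable_first_coords].
  + by move=> t; rewrite /= F0 FM.
move=> x; under eq_fun do rewrite h_E.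
apply: IH => //.
- by move=> j jk; exact: Gal.
- by move=> n j jk; exact: aal.
- by move=> n j jk; exact: ab.
- exact: cvg_pinfty_shift.
- by move=> j jk; apply: cvg_ratio_shift => //; exact: bm.
Unshelve. all: by end_near. Qed.

End stick_limit.

(** * Measures on tuples and random signs *)

Section density_measure.
Context d (T : measurableType d) (R : realType).
Local Open Scope ereal_scope.

Lemma density_measure_exists (mu : {measure set T -> \bar R}) (h : T -> R) :
  measurable_fun setT h -> (forall x, (0 <= h x)%R) ->
  exists nu : {measure set T -> \bar R},
    forall A, nu A = \int[mu]_(x in A) (h x)%:E.
Proof.
move=> mh h0; pose nu A := \int[mu]_(x in A) (h x)%:E.
have nu0 : nu set0 = 0 by rewrite /nu integral_set0.
have nu_ge0 A : 0 <= nu A by apply: integral_ge0 => x _; rewrite lee_fin.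
have nu_sigma : semi_sigma_additive nu.
  move=> /= A mA tA mUA; rewrite /nu ge0_integral_bigcup//=; last 2 first.
  - by apply/measurable_EFinP; exact: measurable_funTS.
  - by move=> x _; rewrite lee_fin.
  by apply: is_cvg_ereal_nneg_natsum_cond => n _ _; exact: nu_ge0.
pose s := isMeasure.Build _ T R nu nu0 nu_ge0 nu_sigma.
pose nu' : {measure set T -> \bar R} := HB.pack nu s.
by exists nu'.
Qed.

End density_measure.

Section tuple_measure.
Context (R : realType) (n : nat).

Definition box (A : 'I_n -> set R) : set (n.-tuple R) :=
  [set t | forall i, A i (tnth t i)].

Lemma measurable_box A : (forall i, measurable (A i)) -> measurable (box A).
Proof.
move=> mA; rewrite (_ : box A =
    \bigcap_(i in [set: 'I_n]) ((@tnth _ R ^~ i) @^-1` A i)).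
  apply: fin_bigcap_measurable => // i _.
  by rewrite -[X in measurable X]setTI; exact: measurable_tnth.
by apply/seteqP; split => t /= h i; [move=> _|]; exact: h.
Qed.

(** Boxes are stable under intersection and generate the product sigma-algebra; finiteness of [m1]
    supplies the exhaustion. *)
Lemma tuple_measure_unique (m1 m2 : {measure set (n.-tuple R) -> \bar R}) :
  (m1 setT < +oo)%E ->
  (forall A, (forall i, measurable (A i)) -> m1 (box A) = m2 (box A)) ->
  forall B, measurable B -> m1 B = m2 B.
Proof.
move=> m1oo m12.
pose G := [set box A | A in [set A : 'I_n -> set R | forall i, measurable (A i)]].
have GT : G setT by exists (fun=> setT) => //; apply/seteqP; split.
apply: (measure_unique G (fun=> setT)) => //.
- apply/seteqP; split; last first.
    apply: smallest_sub; first exact: sigma_algebra_measurable.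
    by move=> _ [A mA <-]; exact: measurable_box.
  (* Boxes constraining a single coordinate make every projection measurable for the generated
     sigma-algebra, hence also the identity into tuples. *)
  pose T' := g_sigma_algebraType G.
  have mid : measurable_fun [set: T'] (id : T' -> n.-tuple R).
    apply/measurable_fun_tnthP => i _ Y mY; rewrite setTI.
    apply: sub_sigma_algebra; exists (fun j => if j == i then Y else setT).
      by move=> j /=; case: ifP.
    apply/seteqP; split => t /=; first by move=> /(_ i); rewrite eqxx.
    by move=> Yt j; case: eqP => [->|].
  by move=> B mB; have := mid measurableT B mB; rewrite setTI.
- move=> _ _ [A mA <-] [B mB <-]; exists (fun i => A i `&` B i).
    by move=> i; exact: measurableI.
  apply/seteqP; split => t /=; first by move=> h; split => i; have [] := h i.
  by move=> [hA hB] i; split; [exact: hA|exact: hB].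
- by rewrite bigcup_const.
- by move=> _ [A mA <-]; exact: m12.
Qed.

(* Rounding each coordinate down to a multiple of 1/(N+1) exhibits f as a
   pointwise limit of functions that are constant on countably many boxes. *)
Lemma measurable_continuous_tuple_row (f : 'rV[R]_n -> R) : continuous f ->
  measurable_fun setT (fun t : n.-tuple R => f (tuple_row t)).
Proof.
move=> cf.
pose fl N (x : R) : int := Num.floor (x * N.+1%:R).
pose back N (v : n.-tuple int) : 'rV[R]_n := \row_i ((tnth v i)%:~R / N.+1%:R).
pose code N (t : n.-tuple R) : n.-tuple int := [tuple fl N (tnth t i) | i < n].
apply: (@measurable_fun_cvg _ _ _ _ (fun N t => f (back N (code N t)))).
  move=> N _ Y mY; rewrite setTI.
  (* The cells of the grid are boxes indexed by integer vectors, of which there are countably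
     many. *)
  rewrite (_ : _ @^-1` Y = \bigcup_v (if f (back N v) \in Y then
      box (fun i => [set` `[(tnth v i)%:~R / N.+1%:R,
                            (tnth v i + 1)%:~R / N.+1%:R[]) else set0)).
    apply: countable_bigcupT_measurable => // v; case: ifP => // _.
    by apply: measurable_box => i; exact: measurable_itv.
  have Ebox t v : box (fun i => [set` `[(tnth v i)%:~R / N.+1%:R,
      (tnth v i + 1)%:~R / N.+1%:R[]) t <-> v = code N t.
    have E i : tnth t i \in `[(tnth v i)%:~R / N.+1%:R,
        (tnth v i + 1)%:~R / N.+1%:R[ = (fl N (tnth t i) == tnth v i).
      by rewrite in_itv/= ler_pdivrMr ?ltr_pdivlMr ?ltr0n// /fl floor_eq.
    split=> [bt|vE i].
      apply/eq_from_tnth => i; rewrite tnth_mktuple; apply/esym/eqP.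
      by rewrite -E; exact: bt.
    by apply: (etrans (E i)); rewrite vE tnth_mktuple eqxx.
  apply/seteqP; split => t /=.
    move=> Yt; exists (code N t) => //; rewrite mem_set//.
    exact/Ebox.
  move=> [v _]; case: ifPn => // /set_mem Yv /Ebox <-//.
move=> t _; apply: continuous_cvg; first exact: cf.
apply/cvg_ballP => e e0; near=> N; split => // i j.
rewrite !mxE tnth_mktuple /ball/= /fl.
set x := tnth t j.
have N0 : 0 < N.+1%:R :> R by rewrite ltr0n.
have /andP[lo hi] := floor_itv (x * N.+1%:R).
have xe : `|x - (Num.floor (x * N.+1%:R))%:~R / N.+1%:R| <= N.+1%:R^-1.
  rewrite ger0_norm ?subr_ge0 ?ler_pdivrMr// lerBlDr.
  rewrite -[X in X + _]mul1r -mulrDl ler_pdivlMr//.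
  by rewrite ltW// (lt_le_trans hi)// intrD addrC.
apply: (le_lt_trans xe).
near: N.
exact: (near_infty_natSinv_lt (PosNum e0)).
Unshelve. all: by end_near. Qed.

End tuple_measure.

(** * Averaging over random signs *)

Section signs.
Local Open Scope ereal_scope.
Context d (T : measurableType d) (R : realType) (P : probability T R).
Variables (k n : nat) (eps : 'I_k -> T -> R) (W : T -> n.-tuple R).
Variable h : n.-tuple R -> R.
Hypothesis meps : forall j, measurable_fun setT (eps j).
Hypothesis rad : forall j, rademacher P (eps j).
Hypothesis mW : measurable_fun setT W.
Hypothesis mh : measurable_fun setT h.
Hypothesis h0 : forall x, (0 <= h x)%R.

Definition sgn_of (b : bool) : R := if b then (-1)%R else 1%R.

Definition sign_event (s : {ffun 'I_k -> bool}) : set T :=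
  [set w | forall j, eps j w = sgn_of (s j)].

Hypothesis law : forall s A, measurable A ->
  P (sign_event s `&` W @^-1` A) =
  ((2^-1) ^+ k)%:E * \int[lebesgue_tuple n]_(x in A) (h x)%:E.

Lemma measurable_eps_eq j (c : R) : measurable [set w | eps j w = c].
Proof.
by have := @meps j measurableT [set c] (measurable_set1 _); rewrite setTI.
Qed.

Lemma measurable_sign_event s : measurable (sign_event s).
Proof.
rewrite (_ : sign_event s =
    \bigcap_(j in [set: 'I_k]) [set w | eps j w = sgn_of (s j)]).
  by apply: fin_bigcap_measurable => // j _; exact: measurable_eps_eq.
by apply/seteqP; split => w /= h' j; [move=> _|]; exact: h'.
Qed.

Lemma N1_neq1 : (-1 <> 1 :> R)%R.
Proof. by move/eqP; rewrite eqNr oner_eq0. Qed.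

(** The two atoms are disjoint and have total mass 1. *)
Lemma rademacher_ae j : {ae P, forall w, eps j w = 1%R \/ eps j w = (-1)%R}.
Proof.
pose A := [set w | eps j w = 1%R]; pose B := [set w | eps j w = (-1)%R].
have mA : measurable A by exact: measurable_eps_eq.
have mB : measurable B by exact: measurable_eps_eq.
have PAB : P (A `|` B) = 1.
  rewrite measureU//; last first.
    apply/seteqP; split => w // -[w1 wN1].
    by apply: N1_neq1; rewrite -[RHS]w1 -[LHS]wN1.
  have [PA PB] := rad j; transitivity ((2^-1)%:E + (2^-1)%:E : \bar R).
    by congr (_ + _).
  by rewrite -EFinD; congr EFin; rewrite [RHS](splitr 1%R) div1r.
exists (~` (A `|` B)); split.
- by apply: measurableC; exact: measurableU.
- by rewrite probability_setC ?PAB ?subee//; exact: measurableU.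
- by move=> w /= nw.
Qed.

(** The sign events partition the space up to a null set, and by [law] each of them carries [W] with
    density [2^-k h]. One statement serves both the limit vector and the Dirichlet vector. *)
Lemma ge0_integral_signs (g : T -> \bar R)
    (G : {ffun 'I_k -> bool} -> n.-tuple R -> \bar R) :
  measurable_fun setT g -> (forall w, 0 <= g w) ->
  (forall s, measurable_fun setT (G s)) -> (forall s x, 0 <= G s x) ->
  (forall s w, sign_event s w -> g w = G s (W w)) ->
  \int[P]_w g w = \int[lebesgue_tuple n]_x
     ((h x)%:E * (((2^-1) ^+ k)%:E * \sum_s G s x)).
Proof.
move=> mg g0 mG G0 gG.
pose c : R := ((2^-1) ^+ k)%R.
have c0 : (0 <= c)%R by rewrite exprn_ge0// invr_ge0.
have mind s : measurable_fun setT (fun w => (\1_(sign_event s) w : R)%:E : \bar R).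
  by apply/measurable_EFinP/measurable_indic; exact: measurable_sign_event.
have mGW s : measurable_fun setT (fun w => G s (W w) * (\1_(sign_event s) w)%:E).
  by apply: emeasurable_funM => //; exact: measurableT_comp.
have GW0 s w : 0 <= G s (W w) * (\1_(sign_event s) w)%:E.
  by rewrite mule_ge0 ?lee_fin.
transitivity (\int[P]_w (\sum_s G s (W w) * (\1_(sign_event s) w)%:E)).
  apply: ge0_ae_eq_integral => //.
  - exact: emeasurable_sum.
  - by move=> w _; exact: sume_ge0.
  have : {ae P, forall w, forall j, eps j w = 1%R \/ eps j w = (-1)%R}.
    by apply: filter_forall => j; exact: rademacher_ae.
  apply: filterS => w hw _.
  pose s := [ffun j => eps j w != 1%R].
  have ws : sign_event s w.
    move=> j; rewrite /s ffunE; case: eqP => [->//|/=].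
    by have [|] := hw j.
  rewrite (bigD1 s)//= big1 => [|s' ss'].
    by rewrite adde0 indicE mem_set// mule1; exact: gG.
  rewrite indicE memNset ?mule0// => ws'; move/eqP: ss'; apply.
  apply/ffunP => j; have := ws j; rewrite (ws' j) /sgn_of.
  have := N1_neq1.
  by case: (s' j); case: (s j) => // N1 e; case: N1; (exact: e || exact: (esym e)).
rewrite ge0_integral_sum//.
transitivity (\sum_s \int[lebesgue_tuple n]_x (G s x * (c * h x)%:E)).
  apply: eq_bigr => s _.
  have mE := measurable_sign_event s.
  (* Restricting [P] to the sign event and pushing forward along [W] produces the measure described
     by [law]. *)
  pose r : {measure set T -> \bar R} := mrestr P mE.
  transitivity (\int[r]_w G s (W w)).
    apply/esym/(ge0_integral_density P r (\1_(sign_event s))) => //.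
    - move=> A mA; rewrite integral_indic// setIC.
      by rewrite /r/= /mrestr setIC.
    - exact: measurableT_comp.
  pose q : {measure set (n.-tuple R) -> \bar R} :=
    measure_function_pushforward__canonical__measure_function_Measure r mW.
  transitivity (\int[q]_x G s x); first by rewrite ge0_integral_pushforward.
  apply: ge0_integral_density => //.
  - exact: measurable_funM.
  - by move=> x; rewrite mulr_ge0.
  - move=> A mA; rewrite [LHS](_ : _ = P (sign_event s `&` W @^-1` A)).
      rewrite law//; under [RHS]eq_integral do rewrite EFinM.
      rewrite ge0_integralZl//.
      - by apply/measurable_EFinP; exact: measurable_funTS.
      - by move=> x _; rewrite lee_fin.
    by rewrite /q/= /pushforward /r/= /mrestr setIC.
rewrite -ge0_integral_sum//.
- apply: eq_integral => x _.
  rewrite -ge0_sume_distrl// muleC EFinM -muleA muleCA; congr (_ * _).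
- move=> s; apply: emeasurable_funM => //; apply/measurable_EFinP.
  exact: measurable_funM.
- by move=> s x _; rewrite mule_ge0// lee_fin mulr_ge0.
Qed.

End signs.

(** * Nonzero normalizing constants; expectations of bounded functions *)

Section probability_facts.
Context (R : realType) d (T : measurableType d) (P : probability T R).
Local Open Scope ereal_scope.

(** Were it 0, its inverse would be 0 as well, and the density would vanish identically instead of
    having mass 1. *)
Lemma Gamma_fun_neq0 (a q : R) (Z : T -> measurableTypeR R) :
  has_density P lebesgue_measure Z (gamma_pdf a q) -> Gamma_fun a != 0%R.
Proof.
move=> /(_ setT measurableT); rewrite preimage_setT probability_setT => P1.
apply/eqP => G0; suff : (1 : \bar R) = 0 by move=> [] /eqP; rewrite oner_eq0.
rewrite P1 integral0_eq// => x _.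
by rewrite /gamma_pdf G0 invr0 mulr0 !mul0r; case: ifP.
Qed.

(** The same mass argument makes the product [gd_norm] nonzero, hence each of its factors. *)
Lemma beta_norm_neq0 N (a b : nat -> R) (rho : T -> N.-tuple R) :
  has_density P (lebesgue_tuple N) rho (gd_pdf a b) ->
  forall j, (j < N)%N -> beta_norm (a j) (b j) != 0%R.
Proof.
move=> /(_ setT measurableT); rewrite preimage_setT probability_setT => P1.
suff : gd_norm N a b != 0%R.
  by move=> /prodf_neq0 ab j jN; exact: (ab (Ordinal jN)).
apply/eqP => G0; suff : (1 : \bar R) = 0 by move=> [] /eqP; rewrite oner_eq0.
by rewrite P1 integral0_eq// => x _; rewrite /gd_pdf G0 invr0 !mul0r mulr0.
Qed.

(** Trades the expectation of a signed bounded function for the integral of a nonnegative one. *)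
Lemma expectation_addK (g : T -> R) (K : R) : measurable_fun setT g ->
  (forall w, `|g w| <= K)%R ->
  'E_P[g] = \int[P]_w (g w + K)%:E - K%:E.
Proof.
move=> mg gK; rewrite unlock.
have ig : P.-integrable setT (EFin \o g).
  apply: (@le_integrable _ _ _ _ _ measurableT _ (cst K%:E)).
  - exact/measurable_EFinP.
  - by move=> w _ /=; rewrite lee_fin (le_trans (gK w))// ler_norm.
  - exact: finite_measure_integrable_cst.
under [in RHS]eq_integral do rewrite EFinD.
rewrite integralD//; last exact: finite_measure_integrable_cst.
have -> : \int[P]_w K%:E = K%:E.
  by rewrite integral_cst//= probability_setT mule1.
by rewrite addeK.
Qed.

Lemma rademacher_sgn (e : T -> R) (b : bool) :
  rademacher P e -> P [set w | e w = sgn_of R b] = (2^-1)%:E.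
Proof. by case: b => -[]. Qed.

End probability_facts.

Lemma same_law_ge0_integral (R : realType) d1 d2 d'
    (T1 : measurableType d1) (T2 : measurableType d2) (T' : measurableType d')
    (P1 : probability T1 R) (P2 : probability T2 R) (X1 : T1 -> T')
    (X2 : T2 -> T') (g : T' -> \bar R) :
  measurable_fun setT X1 -> measurable_fun setT X2 ->
  same_law P1 P2 X1 X2 -> measurable_fun setT g -> (forall x, 0 <= g x)%E ->
  (\int[P1]_w g (X1 w) = \int[P2]_w g (X2 w))%E.
Proof.
move=> m1 m2 law mg g0.
rewrite -[LHS](ge0_integral_pushforward m1 P1 measurableT (f := g))//.
rewrite -[RHS](ge0_integral_pushforward m2 P2 measurableT (f := g))//.
apply: eq_measure_integral => A mA _; exact: law.
Qed.

(** * The joint law of the limiting signs and Gamma variables *)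

Section limit_law.
Context (R : realType) (p : R).
Local Notation mu := (@lebesgue_measure R).
Local Open Scope ereal_scope.

Lemma integral_gamma_prod_box k (al : nat -> R) (A : 'I_k -> set R) :
  (forall j, measurable (A j)) ->
  \int[lebesgue_tuple k]_t ((gamma_prod_pdf p al t)%:E * (\1_(box A) t)%:E) =
  \prod_(j < k) \int[mu]_(x in A j) (gamma_pdf (al j) p^-1 x)%:E.
Proof.
elim: k al A => [|k IH] al A mA.
  rewrite integral_lebesgue_tuple0; last first.
    apply: emeasurable_funM; apply/measurable_EFinP.
      exact: measurable_gamma_prod_pdf.
    by apply: measurable_indic; exact: measurable_box.
  rewrite big_ord0 /gamma_prod_pdf big_ord0 mul1e indicE mem_set//.
  by move=> -[].
rewrite integral_gamma_prod_pdfS; last 2 first.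
- by apply/measurable_EFinP/measurable_indic; exact: measurable_box.
- by move=> t; rewrite lee_fin.
rewrite big_ord_recl -(IH (fun j => al j.+1))//.
have Ebox x (t : k.-tuple R) : (\1_(box A) (cons_pair (x, t)))%:E =
    (\1_(A ord0) x)%:E * (\1_(box (fun j => A (lift ord0 j))) t)%:E :> \bar R.
  rewrite -EFinM !indicE -natrM mulnb; congr (nat_of_bool _)%:R%:E.
  apply/idP/idP; rewrite !inE => /=.
    move=> bA; apply/andP; split; rewrite inE.
      exact: (bA ord0).
    by move=> j; have := bA (lift ord0 j); rewrite /cons_pair tnthS.
  move=> /andP[]; rewrite !inE => A0 bA j.
  by case: (unliftP ord0 j) => [i|] ->; rewrite /cons_pair ?tnthS//; exact: bA.
set B := \int[lebesgue_tuple k]_t _.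
have B0 : 0 <= B.
  by apply: integral_ge0 => t _; rewrite mule_ge0 ?lee_fin ?gamma_prod_pdf_ge0.
have mg : measurable_fun (A ord0) (fun x => (gamma_pdf (al 0%N) p^-1 x)%:E : \bar R).
  apply/measurable_EFinP; apply: measurable_funTS; exact: measurable_gamma_pdf.
have g0 x : A ord0 x -> 0 <= (gamma_pdf (al 0%N) p^-1 x)%:E.
  by rewrite lee_fin gamma_pdf_ge0.
transitivity (\int[mu]_(x in A ord0) ((gamma_pdf (al 0%N) p^-1 x)%:E * B)); last first.
  by rewrite (ge0_integralZr mu (mA ord0) mg g0 B0).
rewrite [RHS]integral_mkcond.
apply: eq_integral => x _.
under eq_integral do rewrite Ebox muleCA.
rewrite ge0_integralZl//; last 2 first.
- apply: emeasurable_funM; apply/measurable_EFinP.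
    exact: measurable_gamma_prod_pdf.
  by apply: measurable_indic; exact: measurable_box.
- by move=> t _; rewrite mule_ge0 ?lee_fin ?gamma_prod_pdf_ge0.
by rewrite epatch_indic /= -muleA; congr (_ * _); rewrite muleC.
Qed.

Section independent.
Context d (T : measurableType d) (Q : probability T R) (k : nat).
Variables (eps Z : 'I_k -> {RV Q >-> R}) (al : nat -> R).
Hypothesis indep : mutually_independent Q (fun i : 'I_k + 'I_k =>
      match i with
      | inl j => sigma_generated (eps j)
      | inr j => sigma_generated (Z j)
      end).
Hypothesis eps_law : forall j, rademacher Q (eps j).
Hypothesis Z_law : forall j,
  has_density Q lebesgue_measure (Z j) (gamma_pdf (al j) p^-1).

Definition joint (w : T) : k.-tuple R := [tuple Z j w | j < k].

Lemma measurable_joint : measurable_fun setT joint.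
Proof.
apply/measurable_fun_tnthP => j.
rewrite (_ : _ \o _ = Z j); first exact: measurable_funP.
by apply/funext => w /=; rewrite tnth_mktuple.
Qed.

Lemma sign_event_box (s : {ffun 'I_k -> bool}) (A : 'I_k -> set R) :
  (forall j, measurable (A j)) ->
  Q (sign_event eps s `&` joint @^-1` box A) =
  ((2^-1) ^+ k)%:E * \prod_(j < k) Q (Z j @^-1` A j).
Proof.
move=> mA; pose E (i : 'I_k + 'I_k) : set T :=
  match i with
  | inl j => [set w | eps j w = sgn_of R (s j)]
  | inr j => Z j @^-1` A j
  end.
have -> : sign_event eps s `&` joint @^-1` box A =
    \bigcap_(i in [set` [set: 'I_k + 'I_k]%SET]) E i.
  apply/seteqP; split => w /=.
    move=> [sw bw] [j|j] _ /=; first exact: sw.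
    by have := bw j; rewrite tnth_mktuple.
  move=> Ew; split => j; first by apply: (Ew (inl j)); rewrite /= inE.
  by rewrite tnth_mktuple; apply: (Ew (inr j)); rewrite /= inE.
rewrite indep; last first.
  move=> [j|j] _ /=.
    by exists [set sgn_of R (s j)]; [exact: measurable_set1|rewrite setTI].
  by exists (A j) => //; rewrite setTI.
rewrite (eq_bigl xpredT); last by move=> i; rewrite inE.
rewrite big_sumType/=; congr (_ * _).
under eq_bigr do rewrite rademacher_sgn//.
by rewrite prodEFin prodr_const card_ord.
Qed.

(** Both sides are finite measures in [A] that agree on boxes: independence factorizes the left one,
    Tonelli the right one. *)
Lemma joint_law (s : {ffun 'I_k -> bool}) (A : set (k.-tuple R)) : measurable A ->
  Q (sign_event eps s `&` joint @^-1` A) =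
  ((2^-1) ^+ k)%:E * \int[lebesgue_tuple k]_(t in A) (gamma_prod_pdf p al t)%:E.
Proof.
move=> mA.
have mE : measurable (sign_event eps s).
  by apply: measurable_sign_event => j; exact: measurable_funP.
pose r : {measure set T -> \bar R} := mrestr Q mE.
pose m1 : {measure set (k.-tuple R) -> \bar R} :=
  measure_function_pushforward__canonical__measure_function_Measure r measurable_joint.
have [nu nuE] := density_measure_exists (lebesgue_tuple k)
  (@measurable_gamma_prod_pdf R p k al) (gamma_prod_pdf_ge0 p al).
have c0 : (0 <= 2^-1 ^+ k :> R)%R by rewrite exprn_ge0// invr_ge0.
pose m2 : {measure set (k.-tuple R) -> \bar R} := mscale (NngNum c0) nu.
have m1E B : m1 B = Q (sign_event eps s `&` joint @^-1` B).
  by rewrite /m1/= /pushforward /r/= /mrestr setIC.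
have m2E B : m2 B = ((2^-1) ^+ k)%:E *
    \int[lebesgue_tuple k]_(t in B) (gamma_prod_pdf p al t)%:E.
  by rewrite /m2/= /mscale/= nuE.
rewrite -m1E -m2E; apply: tuple_measure_unique => //.
  rewrite m1E; apply: le_lt_trans (ltry 1); apply: probability_le1.
  by apply: measurableI => //; rewrite preimage_setT.
move=> B mB; rewrite m1E m2E sign_event_box//; congr (_ * _).
rewrite integral_mkcond.
transitivity (\int[lebesgue_tuple k]_t ((gamma_prod_pdf p al t)%:E * (\1_(box B) t)%:E)).
  rewrite integral_gamma_prod_box//; apply: eq_bigr => j _; exact: (Z_law _ (mB j)).
by apply: eq_integral => t _; rewrite epatch_indic.
Qed.

End independent.
End limit_law.

(** * Both expectations as integrals of the same sign average *)

Section sign_average.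
Context (R : realType) (p : R) (k : nat).
Local Open Scope ereal_scope.

Definition signed_root (s : {ffun 'I_k -> bool}) (z : k.-tuple R) : k.-tuple R :=
  [tuple sgn_of R (s j) * tnth z j `^ p^-1 | j < k]%R.

Lemma measurable_signed_root s : measurable_fun setT (signed_root s).
Proof.
apply/measurable_fun_tnthP => j.
rewrite (_ : _ \o _ = fun z => sgn_of R (s j) * tnth z j `^ p^-1)%R; last first.
  by apply/funext => z /=; rewrite tnth_mktuple.
apply: measurable_funM => //; apply: (measurableT_comp (measurable_powR _)).
exact: measurable_tnth.
Qed.

Variable phi : k.-tuple R -> R.
Hypothesis mphi : measurable_fun setT phi.
Hypothesis phi0 : forall t, (0 <= phi t)%R.

(** The expectation of [phi] at the signed roots of [z] over independent uniform signs. It is a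
    fixed bounded function of [z], so only the law of [z] depends on [N]. *)
Definition sign_avg (z : k.-tuple R) : \bar R :=
  ((2^-1) ^+ k)%:E * \sum_s (phi (signed_root s z))%:E.

Lemma measurable_phi_signed_root s :
  measurable_fun setT (fun z => (phi (signed_root s z))%:E : \bar R).
Proof.
by apply/measurable_EFinP; apply: measurableT_comp => //; exact: measurable_signed_root.
Qed.

Lemma measurable_sign_avg : measurable_fun setT sign_avg.
Proof.
apply: emeasurable_funM => //; apply: emeasurable_sum => s.
exact: measurable_phi_signed_root.
Qed.

Lemma sign_avg_ge0 z : 0 <= sign_avg z.
Proof.
rewrite mule_ge0 ?lee_fin ?exprn_ge0 ?invr_ge0// sume_ge0// => s _.
by rewrite lee_fin.
Qed.

Lemma sign_avg_le (M : R) z : (forall t, phi t <= M)%R -> sign_avg z <= M%:E.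
Proof.
move=> phiM; rewrite /sign_avg sumEFin -EFinM lee_fin.
apply: (@le_trans _ _ ((2^-1) ^+ k * \sum_(s : {ffun 'I_k -> bool}) M)%R).
  by rewrite ler_wpM2l ?exprn_ge0 ?invr_ge0// ler_sum.
rewrite sumr_const card_ffun card_bool card_ord -(mulr_natl M) natrX mulrA -exprMn.
by rewrite mulVf ?pnatr_eq0// expr1n mul1r.
Qed.

Lemma integral_limit_law d (T : measurableType d) (Q : probability T R)
    (eps Z : 'I_k -> {RV Q >-> R}) (al : nat -> R) :
  mutually_independent Q (fun i : 'I_k + 'I_k =>
      match i with
      | inl j => sigma_generated (eps j)
      | inr j => sigma_generated (Z j)
      end) ->
  (forall j, rademacher Q (eps j)) ->
  (forall j : 'I_k,
    has_density Q lebesgue_measure (Z j) (gamma_pdf (al j) p^-1)) ->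
  \int[Q]_w (phi [tuple eps j w * Z j w `^ p^-1 | j < k]%R)%:E =
  \int[lebesgue_tuple k]_t ((gamma_prod_pdf p al t)%:E * sign_avg t).
Proof.
move=> indep eps_law Z_law.
apply: (@ge0_integral_signs _ _ _ Q k k (fun j => eps j) (joint Z)
  (gamma_prod_pdf p al) _ _ _ _ _ _ _
  (fun s z => (phi (signed_root s z))%:E)) => //.
- exact: measurable_joint.
- exact: measurable_gamma_prod_pdf.
- exact: gamma_prod_pdf_ge0.
- by move=> s A mA; exact: joint_law.
- apply/measurable_EFinP; apply: measurableT_comp => //.
  apply/measurable_fun_tnthP => j.
  rewrite (_ : _ \o _ = fun w => eps j w * Z j w `^ p^-1)%R; last first.
    by apply/funext => z /=; rewrite tnth_mktuple.
  by apply: measurable_funM => //; apply: (measurableT_comp (measurable_powR _)).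
- by move=> w; rewrite lee_fin.
- exact: measurable_phi_signed_root.
- by move=> s x; rewrite lee_fin.
- move=> s w sw; congr (phi _)%:E; apply/eq_from_tnth => j.
  by rewrite !tnth_mktuple sw.
Qed.

(** Averages out the first [k] signs and rescales the stick to length [N]. The nonvanishing of the
    normalizing constants is delivered here too, since it is read off the [rho] hidden in the
    existential. *)
Lemma integral_dirichlet_law N (a b : nat -> R) d (T : measurableType d)
    (P : probability T R) (X : {RV P >-> N.-tuple R}) :
  (k <= N)%N -> (0 < N)%N -> p_generalized_dirichlet p a b X ->
  \int[P]_w (phi [tuple N%:R `^ p^-1 * nth 0 (X w) j | j < k]%R)%:E =
    stick_int N a b N%:R (sign_avg \o @first_coords R k N)
  /\ (forall j, (j < N)%N -> beta_norm (a j) (b j) != 0%R).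
Proof.
move=> kN N0 [d' [T' [Q [rho [eps [rho_law eps_law indep law]]]]]].
split; last exact: beta_norm_neq0 rho_law.
pose W := fun j : 'I_k => widen_ord kN j.
pose Y w := [tuple eps i w * tnth (rho w) i `^ p^-1 | i < N]%R.
pose g (t : N.-tuple R) : \bar R :=
  (phi [tuple N%:R `^ p^-1 * nth 0 t j | j < k]%R)%:E.
pose psi s (x : N.-tuple R) : \bar R :=
  (phi [tuple N%:R `^ p^-1 * (sgn_of R (s j) * tnth x (W j) `^ p^-1) | j < k]%R)%:E.
have nthW (t : N.-tuple R) (j : 'I_k) : nth 0%R t j = tnth t (W j).
  by rewrite (tnth_nth 0%R).
have mg : measurable_fun setT g.
  apply/measurable_EFinP; apply: measurableT_comp => //.
  apply/measurable_fun_tnthP => j.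
  rewrite (_ : _ \o _ = fun t => N%:R `^ p^-1 * tnth t (W j))%R; last first.
    by apply/funext => t /=; rewrite tnth_mktuple nthW.
  by apply: measurable_funM => //; exact: measurable_tnth.
have mY : measurable_fun setT Y.
  apply/measurable_fun_tnthP => j.
  rewrite (_ : _ \o _ = fun w => eps j w * tnth (rho w) j `^ p^-1)%R; last first.
    by apply/funext => z /=; rewrite tnth_mktuple.
  apply: measurable_funM => //; apply: (measurableT_comp (measurable_powR _)).
  by apply: (measurableT_comp (measurable_tnth j)); exact: measurable_funP.
have mrho : measurable_fun setT rho by exact: measurable_funP.
have mgd : measurable_fun setT (fun x : N.-tuple R => gd_pdf a b x).
  under eq_fun do rewrite gd_pdf_stick.
  exact: measurable_stick_pdf.
have gd0 (x : N.-tuple R) : (0 <= gd_pdf a b x)%R.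
  by rewrite gd_pdf_stick stick_pdf_ge0.
have mpsi s : measurable_fun setT (psi s).
  apply/measurable_EFinP; apply: measurableT_comp => //.
  apply/measurable_fun_tnthP => j.
  rewrite (_ : _ \o _ = fun t => N%:R `^ p^-1 *
      (sgn_of R (s j) * tnth t (W j) `^ p^-1))%R; last first.
    by apply/funext => t /=; rewrite tnth_mktuple.
  do 2 apply: measurable_funM => //; apply: (measurableT_comp (measurable_powR _)).
  exact: measurable_tnth.
have signs_law s A : measurable A ->
    Q (sign_event (fun j : 'I_k => eps (W j)) s `&` rho @^-1` A) =
    ((2^-1) ^+ k)%:E * \int[lebesgue_tuple N]_(x in A) (gd_pdf a b x)%:E.
  move=> mA.
  (* The pattern is extended to all [N] indices so that [E] is total; [J] selects [rho] and the
     first [k] signs, leaving the other signs unconstrained. *)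
  pose s' (i : 'I_N) := if insub (i : nat) is Some j then s j else false.
  have s'W j : s' (W j) = s j.
    by rewrite /s' /= valK.
  pose E (o : option 'I_N) : set T' :=
    if o is Some i then [set w | eps i w = sgn_of R (s' i)] else rho @^-1` A.
  pose J := (None |: [set Some (W j) | j : 'I_k])%SET.
  have -> : sign_event (fun j => eps (W j)) s `&` rho @^-1` A =
      \bigcap_(o in [set` J]) E o.
    apply/seteqP; split => w /=.
      move=> [sw rw] o /=; rewrite !inE => /predU1P[-> //|/imsetP[j _ ->]] /=.
      by rewrite s'W; exact: sw.
    move=> Ew; split; last by apply: (Ew None); rewrite /= !inE.
    move=> j; have := Ew (Some (W j)); rewrite /= s'W; apply.
    by rewrite !inE imset_f// orbT.
  rewrite indep; last first.
    move=> [i|] _ /=.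
      by exists [set sgn_of R (s' i)]; [exact: measurable_set1|rewrite setTI].
    by exists A => //; rewrite setTI.
  have NJ : None \notin [set Some (W j) | j : 'I_k]%SET.
    by apply/imsetP => -[].
  rewrite big_setU1//= rho_law// muleC; congr (_ * _).
  rewrite big_imset/=; last first.
    by move=> i j _ _ [] ij; exact: val_inj.
  under eq_bigr do rewrite rademacher_sgn//.
  by rewrite prodEFin prodr_const cardT/= size_enum_ord.
have mX : measurable_fun setT X by exact: measurable_funP.
have g0 t : 0 <= g t by rewrite lee_fin.
rewrite (same_law_ge0_integral mX mY law mg g0).
rewrite (@ge0_integral_signs _ _ _ Q k N (fun j : 'I_k => eps (W j)) rho
  (gd_pdf a b) _ _ _ _ _ signs_law _ psi)//.
- rewrite -[X in stick_int _ _ _ X](mulr1 N%:R)%R.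
  rewrite -stick_int_scale ?ltr0n//; last 2 first.
  + by apply: measurableT_comp; [exact: measurable_sign_avg|exact: measurable_first_coords].
  + by move=> t; exact: sign_avg_ge0.
  apply: eq_integral => x _; rewrite -gd_pdf_stick.
  have [xS|xS] := pselect (open_simplex x); last first.
    by rewrite /gd_pdf indicE memNset// !mul0r !mul0e.
  congr (_ * (_ * _)); apply: eq_bigr => s _.
  rewrite /psi; congr (phi _)%:E; apply/eq_from_tnth => j.
  rewrite !tnth_mktuple nthW tnth_mktuple powRM//; first by ring.
  by have [/(_ (W j))/ltW] := xS.
- exact: measurableT_comp.
- by move=> s x; rewrite lee_fin; exact: phi0.
- move=> s w sw; congr (phi _)%:E; apply/eq_from_tnth => j.
  by rewrite !tnth_mktuple nthW tnth_mktuple sw.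
Qed.

End sign_average.

(** * The substitution y = x^p *)

Section power_substitution.
Context (R : realType).
Local Notation mu := (@lebesgue_measure R).
Local Notation tR := (measurableTypeR R).

Lemma continuous_powR (q x : R) : 0 < x -> {for x, continuous (fun y => y `^ q)}.
Proof.
move=> x0; apply/differentiable_continuous/derivable1_diffP.
by apply: derivable_powR; rewrite in_itv/= x0.
Qed.

Lemma powR_cvg_right (q s : R) : 0 <= q -> 0 <= s ->
  x `^ q @[x --> s^'+] --> s `^ q.
Proof.
rewrite le_eqVlt => /predU1P[<- _|q0].
  by under eq_fun do rewrite powRr0; rewrite powRr0; exact: cvg_cst.
rewrite le_eqVlt => /predU1P[<-|s0]; first by rewrite powR0 ?gt_eqF//; exact: powR_cvg0.
by apply: cvg_at_right_filter; exact: continuous_powR.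
Qed.

(** Fundamental theorem of calculus; [1 <= p] makes the derivative right-continuous even at
    [s = 0]. *)
Lemma integral_powR (p s t : R) : 1 <= p -> 0 <= s -> s < t ->
  (\int[mu]_(x in `[s, t]) (p * x `^ (p - 1))%:E = (t `^ p - s `^ p)%:E)%E.
Proof.
move=> p1 s0 st; have p0 : 0 < p by exact: lt_le_trans p1.
have t0 : 0 < t by exact: le_lt_trans st.
rewrite EFinB.
apply: (@continuous_FTC2 _ (fun x => p * x `^ (p - 1)) (fun x => x `^ p)) => //.
- apply/continuous_within_itvP => //; split.
  + move=> x; rewrite in_itv/= => /andP[sx _].
    apply: cvgM; first exact: cvg_cst.
    by apply: continuous_powR; exact: le_lt_trans sx.
  + by apply: cvgM; [exact: cvg_cst|apply: powR_cvg_right; rewrite ?subr_ge0].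
  + apply: cvgM; first exact: cvg_cst.
    by apply: cvg_at_left_filter; exact: continuous_powR.
- split.
  + move=> x; rewrite in_itv/= => /andP[sx _]; apply: derivable_powR.
    by rewrite in_itv/= andbT (le_lt_trans s0 sx).
  + by apply: powR_cvg_right => //; exact: ltW.
  + by apply: cvg_at_left_filter; exact: continuous_powR.
- move=> x; rewrite in_itv/= => /andP[sx _].
  by rewrite powR_derive1// in_itv/= andbT (le_lt_trans s0 sx).
Qed.

Section substitution.
Variable p : R.
Hypothesis p1 : 1 <= p.
Let p0 : 0 < p. Proof. exact: lt_le_trans p1. Qed.

Let jac (x : R) : R := p * ppow p x.

Let jac_ge0 x : 0 <= jac x.
Proof. by rewrite mulr_ge0 ?ppow_ge0// ltW. Qed.

Let mjac : measurable_fun setT (jac : tR -> R).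
Proof. by apply: measurable_funM => //; exact: measurable_ppow. Qed.

Let mpow : measurable_fun setT ((fun x => x `^ p) : tR -> tR).
Proof. exact: measurable_powR. Qed.

Lemma powR_itv (a b x : R) : (0 <= a)%R -> (0 < x)%R -> (a < b)%R ->
  (x `^ p \in `]a, b]) = (x \in `]a `^ p^-1, b `^ p^-1]).
Proof.
move=> a0 x0 ab; have b0 : (0 <= b)%R by rewrite ltW// (le_lt_trans a0).
have pV0 : (0 < p^-1)%R by rewrite invr_gt0.
have K y : (0 <= y)%R -> (y `^ p `^ p^-1 = y)%R.
  by move=> y0; rewrite -powRrM divff ?gt_eqF// powRr1.
have K' y : (0 <= y)%R -> (y `^ p^-1 `^ p = y)%R.
  by move=> y0; rewrite -powRrM mulVf ?gt_eqF// powRr1.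
have mono (q y z : R) : (0 < q -> 0 <= y -> 0 <= z -> y <= z -> y `^ q <= z `^ q)%R.
  by move=> q0 y0 z0 yz; apply: ge0_ler_powR => //; exact: ltW.
have xp0 : (0 <= x `^ p)%R by exact: powR_ge0.
rewrite !in_itv/=; congr (_ && _).
  rewrite !ltNge; congr (~~ _); apply/idP/idP => h.
    by rewrite -(K x (ltW x0)); apply: mono => //.
  by rewrite -(K' a)//; apply: mono => //; [exact: ltW|exact: powR_ge0].
apply/idP/idP => h; first by rewrite -(K x (ltW x0)); apply: mono => //.
by rewrite -(K' b)//; apply: mono => //; [exact: ltW|exact: powR_ge0].
Qed.

Local Open Scope ereal_scope.

Let jac_itv (a b : R) : (0 <= a)%R -> (a < b)%R ->
  \int[mu]_(x in (fun x => x `^ p)%R @^-1` `]a, b]) (jac x)%:E = (b - a)%:E.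
Proof.
move=> a0 ab; have b0 : (0 <= b)%R by rewrite ltW// (le_lt_trans a0).
have pV0 : (0 < p^-1)%R by rewrite invr_gt0.
have aV0 : (0 <= a `^ p^-1)%R by exact: powR_ge0.
transitivity (\int[mu]_(x in `](a `^ p^-1)%R, (b `^ p^-1)%R]%classic)
      (p * x `^ (p - 1))%:E).
  rewrite integral_mkcond [RHS]integral_mkcond; apply: eq_integral => x _.
  rewrite !patchE /jac /ppow; have [x0|x0] := ltP 0%R x.
    congr (if _ then _ else _); have E := powR_itv a0 x0 ab.
    by apply/idP/idP => /set_mem h; apply/mem_set; move: h; rewrite /= E.
  rewrite mulr0 if_same; case: ifPn => //; rewrite inE /= in_itv/= => /andP[].
  by move=> /(le_lt_trans aV0); rewrite ltNge x0.
rewrite integral_itv_obnd_cbnd; last first.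
  have mp : measurable_fun setT (fun x : tR => (p * x `^ (p - 1))%R).
    by apply: measurable_funM => //; exact: measurable_powR.
  by apply/measurable_EFinP; exact: measurable_funTS.
rewrite integral_powR//; last first.
  by apply: gt0_ltr_powR => //; rewrite inE.
by rewrite -!powRrM mulVf ?gt_eqF// !powRr1.
Qed.

(** The image [q] of the measure with density [jac] under [x -> x^p] should be Lebesgue measure on
    the positive half-line. As uniqueness concerns the whole line, the restriction [r] of [mu] to
    the nonpositive half-line is added, and [q + r] is compared with [mu] on half-open intervals. *)
Lemma ge0_integral_lebesgue_powR (f : tR -> \bar R) :
  measurable_fun setT f -> (forall y, 0 <= f y) ->
  \int[mu]_y (f y * (\1_(`]0%R, +oo[%classic) y)%:E) =
  \int[mu]_x (f (x `^ p)%R * (p * ppow p x)%:E).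
Proof.
move=> mf f0; have [nu nuE] := density_measure_exists mu mjac jac_ge0.
pose q : {measure set tR -> \bar R} :=
  measure_function_pushforward__canonical__measure_function_Measure nu mpow.
have mneg : measurable (`]-oo, 0%R]%classic : set tR) by exact: measurable_itv.
have mpos : measurable (`]0%R, +oo[%classic : set tR) by exact: measurable_itv.
pose r : {measure set tR -> \bar R} := mrestr mu mneg.
have qE A : q A = \int[mu]_(x in (fun x => x `^ p)%R @^-1` A) (jac x)%:E.
  by rewrite /q/= /pushforward nuE.
have muE A : measurable A -> mu A = measure_add q r A.
  apply: lebesgue_measure_unique => _ /ocitvP[->|[[a b] /= ab ->]].
    by rewrite !measure0.
  apply: (etrans _ (esym (measure_addE q r _))).
  rewrite lebesgue_measure_itv/= lte_fin ab.
  have rE : r `]a, b]%classic = mu (`]a, b] `&` `]-oo, 0%R])%classic by [].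
  have [b0|b0] := leP b 0%R.
    rewrite qE rE integral0_eq ?add0e; last first.
      move=> x; rewrite /= in_itv/= => /andP[_ xb].
      rewrite /jac ppow_le0 ?mulr0// leNgt; apply/negP => x0.
      by have := powR_gt0 p x0; rewrite ltNge (le_trans xb b0).
    rewrite setIidl; last first.
      by move=> x; rewrite /= !in_itv/= => /andP[_ /le_trans]; apply.
    by rewrite lebesgue_measure_itv/= lte_fin ab.
  have [a0|a0] := leP 0%R a.
    rewrite rE (_ : (_ `&` _)%classic = set0) ?measure0 ?adde0; last first.
      apply/seteqP; split => x //=; rewrite !in_itv/= => -[/andP[ax _]].
      by rewrite leNgt (le_lt_trans a0 ax).
    by rewrite qE jac_itv.
  rewrite rE (_ : (_ `&` _)%classic = `]a, 0%R]%classic); last first.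
    apply/seteqP; split => x /=; rewrite !in_itv/=; first by move=> [/andP[-> _] ->].
    by move=> /andP[-> x0]; rewrite x0 (le_trans x0 (ltW b0)).
  rewrite lebesgue_measure_itv/= lte_fin a0.
  (* Since [jac] vanishes for [x <= 0] and [x^p > 0] otherwise, a negative left endpoint may be
     replaced by 0. *)
  rewrite qE (_ : integral _ _ _ =
      \int[mu]_(x in (fun x => x `^ p)%R @^-1` `]0%R, b]) (jac x)%:E).
    by rewrite jac_itv// -!EFinD; congr EFin; ring.
  rewrite integral_mkcond [RHS]integral_mkcond; apply: eq_integral => x _.
  rewrite !patchE /jac; have [x0|x0] := leP x 0%R.
    by rewrite ppow_le0// mulr0 !if_same.
  congr (if _ then _ else _); have xp := powR_gt0 p x0.
  by apply/idP/idP; rewrite !inE /= !in_itv/= => /andP[_ ->]; rewrite ?xp ?(lt_trans a0 xp).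
transitivity (\int[q]_y f y).
  apply/esym/(ge0_integral_density mu q (\1_(`]0%R, +oo[%classic))) => //.
  move=> A mA; rewrite integral_indic// setIC.
  transitivity (q (A `&` `]0%R, +oo[%classic)).
    rewrite !qE integral_mkcond [RHS]integral_mkcond; apply: eq_integral => x _.
    rewrite !patchE /jac; have [x0|x0] := leP x 0%R.
      by rewrite ppow_le0// mulr0 !if_same.
    congr (if _ then _ else _); have xp := powR_gt0 p x0.
    by apply/idP/idP; rewrite !inE /= in_itv/= ?andbT => // -[].
  have mAp : measurable (A `&` `]0%R, +oo[%classic) by exact: measurableI.
  apply/esym; apply: (etrans (muE _ mAp)); rewrite measure_addE.
  have -> : r (A `&` `]0%R, +oo[%classic) = 0; last by rewrite adde0.
  rewrite -(measure0 mu); apply: (congr1 mu); apply/seteqP; split => x //=.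
  by rewrite !in_itv/= andbT => -[[_]]; rewrite ltNge => /negP.
rewrite ge0_integral_pushforward// preimage_setT.
apply: (ge0_integral_density mu nu jac) => //; first exact: measurableT_comp.
by move=> x; exact: f0.
Qed.

End substitution.

Local Open Scope ereal_scope.

(** Reflection invariance carries the negative half-line onto the positive one; the point 0 is
    null. *)
Lemma ge0_integral_lebesgue_fold (f : tR -> \bar R) :
  measurable_fun setT f -> (forall y, 0 <= f y) ->
  \int[mu]_x f x =
  \int[mu]_x ((f x + f (- x)%R) * (\1_(`]0%R, +oo[%classic) x)%:E).
Proof.
move=> mf f0.
have mpos : measurable (`]0%R, +oo[%classic : set tR) by exact: measurable_itv.
have mi : measurable_fun setT
    (fun x : tR => (\1_(`]0%R, +oo[%classic) x : R)%:E : \bar R).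
  exact/measurable_EFinP/measurable_indic.
have mN : measurable_fun setT (-%R : tR -> tR) by exact: measurable_funN.
have mfN : measurable_fun setT (fun x : tR => f (- x)%R) by exact: measurableT_comp.
have miN : measurable_fun setT
    (fun x : tR => (\1_(`]0%R, +oo[%classic) (- x)%R : R)%:E : \bar R).
  exact: (measurableT_comp mi).
pose F (x : tR) := f x * (\1_(`]0%R, +oo[%classic) (- x)%R)%:E.
have mF : measurable_fun setT F by exact: emeasurable_funM.
have F0 x : 0 <= F x by rewrite mule_ge0 ?lee_fin.
under [RHS]eq_integral do rewrite ge0_muleDl//.
rewrite ge0_integralD//; last 4 first.
- by move=> x _; rewrite mule_ge0 ?lee_fin.
- exact: emeasurable_funM.
- by move=> x _; rewrite mule_ge0 ?lee_fin.
- exact: emeasurable_funM.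
have -> : \int[mu]_x (f (- x)%R * (\1_(`]0%R, +oo[%classic) x)%:E) = \int[mu]_x F x.
  pose q : {measure set tR -> \bar R} :=
    measure_function_pushforward__canonical__measure_function_Measure mu mN.
  transitivity (\int[q]_x F x); last first.
    by apply: eq_measure_integral => A mA _; exact: lebesgue_measureN.
  rewrite ge0_integral_pushforward// preimage_setT.
  by apply: eq_integral => x _; rewrite /F /= opprK.
rewrite -ge0_integralD//; last 2 first.
- by move=> x _; rewrite mule_ge0 ?lee_fin.
- exact: emeasurable_funM.
apply: ge0_ae_eq_integral => //.
- by apply: emeasurable_funD => //; exact: emeasurable_funM.
- by move=> x _; rewrite adde_ge0 ?mule_ge0 ?lee_fin.
exists [set 0%R]; split; first exact: measurable_set1.
  exact: lebesgue_measure_set1.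
move=> x /= nx; apply: contra_notP nx => /eqP x0 _.
rewrite /F !indicE.
have [x1|x1] := ltP 0%R x.
  rewrite mem_set/= ?in_itv/= ?x1// memNset ?mule1 ?mule0 ?adde0//=.
  by rewrite in_itv/= oppr_gt0 andbT ltNge ltW.
rewrite memNset/= ?in_itv/= ?ltNge ?x1// mem_set ?mule1 ?mule0 ?add0e//=.
by rewrite in_itv/= andbT oppr_gt0 lt_neqAle x0.
Qed.

End power_substitution.

(** * The limit density *)

(** Events are transported along [f] and completed by [setT]. This extracts one sign and one Gamma
    variable from the full family. *)
Lemma mutually_independent_sub (R : realType) d (T : measurableType d)
    (P : probability T R) (I I' : finType) (f : I -> I')
    (F : I -> set_system T) (F' : I' -> set_system T) :
  injective f -> (forall i, F i = F' (f i)) ->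
  mutually_independent P F' -> mutually_independent P F.
Proof.
move=> finj FF' indep J A FA.
pose A' i' := if [pick i | f i == i'] is Some i then A i else setT.
have A'f i : A' (f i) = A i.
  rewrite /A'; case: pickP => [j /eqP/finj -> //|/(_ i)].
  by rewrite eqxx.
have := indep (f @: J)%SET A'; rewrite big_imset/=; last by move=> i j _ _ /finj.
under eq_bigr do rewrite A'f.
move=> <-; last by move=> _ /imsetP[i iJ ->]; rewrite A'f -FF'; exact: FA.
congr (P _); apply/seteqP; split => w Aw i /=.
  by move=> /imsetP[j jJ ->]; rewrite A'f; exact: Aw.
by move=> iJ; rewrite -A'f; apply: Aw; exact: imset_f.
Qed.

Section density.
Context (R : realType) (p : R).
Hypothesis p1 : 1 <= p.
Local Notation mu := (@lebesgue_measure R).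
Local Notation tR := (measurableTypeR R).
Let p0 : 0 < p. Proof. exact: lt_le_trans p1. Qed.

Definition limit_pdf (a x : R) : R :=
  p `^ (1 - a) / (2 * Gamma_fun a) * `|x| `^ (p * a - 1) * expR (- (`|x| `^ p / p)).

(** Gamma density times Jacobian, halved for the sign: the powers of [x] add up to
    [p (a - 1) + (p - 1) = p a - 1], and [p p^-a = p^(1-a)]. *)
Lemma limit_pdfE (a x : R) : 0 < x ->
  gamma_pdf a p^-1 (x `^ p) * (2^-1 * (p * ppow p x)) = limit_pdf a x.
Proof.
move=> x0; rewrite /gamma_pdf powR_gt0// ppowE// /limit_pdf gtr0_norm//.
rewrite -powRrM -[X in X `^ a]powR_inv1 ?(ltW p0)// -powRrM.
set G := Gamma_fun a.
rewrite [X in expR X](_ : _ = - (x `^ p / p)); last by rewrite mulrC.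
set E := expR _.
rewrite [LHS](_ : _ = p * p `^ (-1 * a) / (2 * G) *
  (x `^ (p * (a - 1)) * x `^ (p - 1)) * E); last by rewrite invfM; ring.
rewrite -{1}[p]powRr1 ?(ltW p0)// -!gt0_powRD//.
congr (_ `^ _ / _ * _ `^ _ * _); ring.
Qed.

Lemma limit_pdfN (a x : R) : limit_pdf a (- x) = limit_pdf a x.
Proof. by rewrite /limit_pdf normrN. Qed.

Local Open Scope ereal_scope.

(** [integral_limit_law] with [k = 1] and [phi] the indicator of [A], followed by [y = x^p]; the
    average over the two signs then unfolds into an integral over the whole line by evenness of
    [limit_pdf]. *)
Lemma signed_root_density (a : R) d (T : measurableType d) (Q : probability T R)
    (eps Z : 'I_1 -> {RV Q >-> R}) :
  mutually_independent Q (fun i : 'I_1 + 'I_1 =>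
      match i with
      | inl j => sigma_generated (eps j)
      | inr j => sigma_generated (Z j)
      end) ->
  (forall j, rademacher Q (eps j)) ->
  (forall j, has_density Q lebesgue_measure (Z j) (gamma_pdf a p^-1)) ->
  has_density Q lebesgue_measure
    (fun w => eps ord0 w * Z ord0 w `^ p^-1)%R (limit_pdf a).
Proof.
move=> indep eps_law Z_law A mA.
have mX : measurable_fun setT (fun w => eps ord0 w * Z ord0 w `^ p^-1)%R.
  by apply: measurable_funM => //; apply: (measurableT_comp (measurable_powR _)).
have mlim : measurable_fun setT (limit_pdf a : tR -> R).
  have mn q : measurable_fun setT (fun x : tR => `|x| `^ q)%R.
    by apply: (measurableT_comp (measurable_powR _)).
  apply: measurable_funM; first by apply: measurable_funM.
  apply: measurableT_comp => //; apply: measurableT_comp => //.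
  exact: measurable_funM.
have lim0 x : (0 <= limit_pdf a x)%R.
  have G0 : (0 <= Gamma_fun a)%R by rewrite Gamma_funE fine_ge0// egamma_ge0.
  by rewrite /limit_pdf !mulr_ge0 ?invr_ge0 ?powR_ge0 ?expR_ge0// mulr_ge0.
pose phi (t : 1.-tuple R) : R := \1_A (tnth t ord0).
have mphi : measurable_fun setT phi.
  apply: (measurableT_comp (measurable_indic mA)); exact: measurable_tnth.
have phi0 t : (0 <= phi t)%R by [].
transitivity (\int[Q]_w (phi [tuple eps j w * Z j w `^ p^-1 | j < 1]%R)%:E).
  under eq_integral do rewrite /phi tnth_mktuple.
  rewrite (_ : (fun w => _) = fun w =>
    (\1_((fun w => eps ord0 w * Z ord0 w `^ p^-1)%R @^-1` A) w)%:E)//.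
  rewrite integral_indic ?setIT//.
  by have := mX measurableT A mA; rewrite setTI.
rewrite (integral_limit_law mphi phi0 indep eps_law (al := fun=> a))//.
rewrite integral_gamma_prod_pdfS; last 2 first.
- exact: measurable_sign_avg.
- by move=> t; exact: sign_avg_ge0.
pose sa (y : R) : \bar R :=
  (2^-1)%:E * ((\1_A (y `^ p^-1)%R)%:E + (\1_A (- (y `^ p^-1))%R)%:E).
have saE y : sign_avg p phi (cons_pair (y, [tuple])) = sa y.
  rewrite /sign_avg expr1; congr (_ * _).
  (* Sign patterns on one coordinate are the two booleans. *)
  rewrite (reindex_onto (fun b : bool => [ffun=> b])
    (fun s : {ffun 'I_1 -> bool} => s ord0))/=; last first.
    move=> s _; apply/ffunP => i; rewrite ffunE; congr (s _).
    by rewrite [RHS]ord1; exact: val_inj.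
  rewrite (eq_bigl xpredT); last by move=> b; rewrite ffunE eqxx.
  rewrite big_bool/= addeC /phi /signed_root; congr (_%:E + _%:E).
    by rewrite tnth_mktuple ffunE mul1r.
  by rewrite tnth_mktuple ffunE mulN1r.
have mind : measurable_fun setT (\1_A : tR -> R) by exact: measurable_indic.
have msa : measurable_fun setT (sa : tR -> \bar R).
  have mr : measurable_fun setT (fun y : tR => (y `^ p^-1)%R).
    exact: measurable_powR.
  apply: emeasurable_funM => //; apply: emeasurable_funD; apply/measurable_EFinP.
    exact: measurableT_comp.
  apply: (measurableT_comp mind); exact: measurableT_comp.
have sa0 y : 0 <= sa y.
  by rewrite mule_ge0 ?lee_fin ?invr_ge0// adde_ge0 ?lee_fin.
pose f (y : tR) := (gamma_pdf a p^-1 y)%:E * sa y.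
have mf : measurable_fun setT f.
  apply: emeasurable_funM => //; apply/measurable_EFinP.
  exact: measurable_gamma_pdf.
have f0 y : 0 <= f y by rewrite mule_ge0// lee_fin gamma_pdf_ge0.
transitivity (\int[mu]_y (f y * (\1_(`]0%R, +oo[%classic) y)%:E)).
  apply: eq_integral => y _.
  rewrite integral_lebesgue_tuple0; last first.
    apply: emeasurable_funM.
      by apply/measurable_EFinP; exact: measurable_gamma_prod_pdf.
    by apply: measurableT_comp; [exact: measurable_sign_avg|exact: measurable_consl].
  rewrite /gamma_prod_pdf big_ord0 mul1e saE /f indicE.
  have [y0|y0] := ltP 0%R y; first by rewrite mem_set ?mule1//= in_itv/= y0.
  by rewrite /gamma_pdf ltNge y0 !mul0e.
rewrite (ge0_integral_lebesgue_powR p1 mf f0).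
rewrite [RHS]integral_mkcond.
pose g (x : tR) : \bar R := (limit_pdf a x)%:E * (\1_A x)%:E.
transitivity (\int[mu]_x g x); last first.
  by apply: eq_integral => x _; rewrite epatch_indic.
rewrite (ge0_integral_lebesgue_fold (f := g)); last 2 first.
- by apply: emeasurable_funM; exact/measurable_EFinP.
- by move=> x; rewrite mule_ge0 ?lee_fin.
apply: eq_integral => x _; rewrite /g limit_pdfN -ge0_muleDr ?lee_fin//.
have [x0|x0] := ltP 0%R x; last first.
  have -> : (\1_(`]0%R, +oo[%classic) x)%:E = 0 :> \bar R.
    by rewrite indicE memNset//= in_itv/= andbT ltNge x0.
  by rewrite ppow_le0// mulr0 !mule0.
have -> : (\1_(`]0%R, +oo[%classic) x)%:E = 1 :> \bar R.
  by rewrite indicE mem_set//= in_itv/= x0.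
rewrite mule1.
rewrite -limit_pdfE// /f /sa -powRrM divff ?gt_eqF// powRr1 ?ltW//.
rewrite !EFinM -!muleA; congr (_ * (_ * _)).
by rewrite muleC -!muleA.
Qed.

End density.

Unset Implicit Arguments.
Set Strict Implicit.

(* In [a N j] and [b N j], N is the dimension and j < N the (0-based) index of
   the parameter; nothing is assumed of dimensions N < k. *)
Theorem theorem3p2 (R : realType) (p : R) (hp : 1 <= p) (k : nat)
    (hk : (0 < k)%N) (alpha : 'I_k -> R) (a b : nat -> nat -> R)
    (apos : forall N j : nat, (k <= N)%N -> (j < N)%N -> 0 < a N j)
    (bpos : forall N j : nat, (k <= N)%N -> (j < N)%N -> 0 < b N j)
    (aconst : forall (N : nat) (j : 'I_k), (k <= N)%N -> a N j = alpha j)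
    (bo : forall j : 'I_k,
      (fun N : nat => p * b N j) =
      (fun N : nat => N%:R : R) +o_\oo (fun N : nat => N%:R : R))
    (d : nat -> measure_display) (T : forall N : nat, measurableType (d N))
    (P : forall N : nat, probability (T N) R)
    (X : forall N : nat, {RV (P N) >-> N.-tuple R})
    (Xlaw : forall N : nat, (k <= N)%N ->
      p_generalized_dirichlet p (a N) (b N) (X N))
    (d' : measure_display) (T' : measurableType d') (Q : probability T' R)
    (eps Z : 'I_k -> {RV Q >-> R})
    (epsZ_indep : mutually_independent Q (fun i : 'I_k + 'I_k =>
      match i with
      | inl j => sigma_generated (eps j)
      | inr j => sigma_generated (Z j)
      end))
    (eps_law : forall j : 'I_k, rademacher Q (eps j))
    (Z_law : forall j : 'I_k,
      has_density Q lebesgue_measure (Z j) (gamma_pdf (alpha j) p^-1)) :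
  cvg_in_distribution P
    (fun (N : nat) (w : T N) =>
       [tuple N%:R `^ p^-1 * nth 0 (X N w) j | j < k])
    Q
    (fun w : T' => [tuple eps j w * Z j w `^ p^-1 | j < k])
  /\
  (forall j : 'I_k,
    has_density Q lebesgue_measure (fun w : T' => eps j w * Z j w `^ p^-1)
      (fun x : R =>
         p `^ (1 - alpha j) / (2 * Gamma_fun (alpha j)) *
         `|x| `^ (p * alpha j - 1) * expR (- (`|x| `^ p / p)))).

Proof.
have p0 : 0 < p by exact: lt_le_trans hp.
(* The limit lemmas index shape parameters by natural numbers; dimension [k] already provides every
   [alpha j]. *)
have Z_law' (j : 'I_k) :
    has_density Q lebesgue_measure (Z j) (gamma_pdf (a k j) p^-1).
  by rewrite aconst.
split; last first.
  move=> j; have /(_ (leqnn k)) aE := aconst k j.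
  apply: (@signed_root_density R p hp (alpha j) _ _ Q (fun=> eps j) (fun=> Z j)) => //.
  pose emb (i : 'I_1 + 'I_1) : 'I_k + 'I_k :=
    match i with inl _ => inl j | inr _ => inr j end.
  apply: (mutually_independent_sub (f := emb)) epsZ_indep => [|[]//].
  by move=> [x|x] [y|y] //= _; rewrite (ord1 x) (ord1 y).
move=> f cf bf.
have [K fK] : exists K, forall x, `|f x| <= K.
  have [M [_ HM]] := bf; exists (`|M| + 1) => x; apply: HM => //.
  by rewrite (le_lt_trans (ler_norm M))// ltrDl.
have K0 : 0 <= K by exact: le_trans (fK 0).
have mf := measurable_continuous_tuple_row cf.
(* Adding the bound [K] makes the test function nonnegative, with values at most [K + K]; the
   constant is subtracted again on both sides. *)
pose phi (t : k.-tuple R) := f (tuple_row t) + K.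
have mphi : measurable_fun setT phi by exact: measurable_funD.
have phi_bnd t : 0 <= phi t <= K + K.
  have := fK (tuple_row t); rewrite ler_norml => /andP[fN fP].
  by rewrite /phi -lerBlDr sub0r fN lerD2r fP.
have phi0 t : 0 <= phi t by have /andP[] := phi_bnd t.
have phiK t : phi t <= K + K by have /andP[] := phi_bnd t.
have EE d0 (T0 : measurableType d0) (P0 : probability T0 R) (Y : T0 -> k.-tuple R) :
    measurable_fun setT Y ->
    ('E_P0[fun w => f (tuple_row (Y w))] = \int[P0]_w (phi (Y w))%:E - K%:E)%E.
  move=> mY; apply: (@expectation_addK _ _ _ P0 (fun w => f (tuple_row (Y w))) K) => //.
  exact: (measurableT_comp mf).
have mlim : measurable_fun setT (fun w => [tuple eps j w * Z j w `^ p^-1 | j < k]).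
  apply/measurable_fun_tnthP => j.
  rewrite (_ : _ \o _ = fun w => eps j w * Z j w `^ p^-1); last first.
    by apply/funext => w /=; rewrite tnth_mktuple.
  by apply: measurable_funM => //; apply: (measurableT_comp (measurable_powR _)).
rewrite EE// (integral_limit_law mphi phi0 epsZ_indep eps_law (al := a k))//.
pose F := sign_avg p phi.
have EN N : (k <= N)%N ->
    ('E_(P N)[fun w => f (tuple_row
       [tuple N%:R `^ p^-1 * nth 0 (X N w) j | j < k]%R)] =
     stick_int N (a N) (b N) N%:R (F \o @first_coords R k N) - K%:E)%E.
  move=> kN; rewrite EE.
    by have [-> _] := integral_dirichlet_law mphi phi0 kN (leq_trans hk kN) (Xlaw N kN).
  apply/measurable_fun_tnthP => j.
  rewrite (_ : _ \o _ = fun w => N%:R `^ p^-1 * nth 0 (X N w) j); last first.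
    by apply/funext => w /=; rewrite tnth_mktuple.
  apply: measurable_funM => //.
  rewrite (_ : (fun _ => _) = fun w => tnth (X N w) (widen_ord kN j)); last first.
    by apply/funext => w; rewrite (tnth_nth 0).
  exact: (measurableT_comp (measurable_tnth _)).
(* The hypotheses concern dimensions [N >= k]. Writing [N = k + n] also gives the shape [k + r n] of
   [cvg_stick_int], with [r] the identity. *)
rewrite -(cvg_shiftn k).
under eq_fun do rewrite EN ?leq_addl// addnC.
apply: cvgeB; [exact: fin_num_adde_defl| |exact: cvg_cst].
apply: (@cvg_stick_int R p p0 k id (a k) (fun n => a (k + n)%N)
  (fun n => b (k + n)%N) (fun n => (k + n)%:R) (K + K) F) => //.
- by move=> j jk; have := Gamma_fun_neq0 (Z_law' (Ordinal jk)).
- move=> n j jk; rewrite (aconst _ (Ordinal jk)) ?leq_addr//.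
  by rewrite (aconst k (Ordinal jk)).
- move=> n; have kN := leq_addr n k.
  by have [_] := integral_dirichlet_law mphi phi0 kN (leq_trans hk kN) (Xlaw _ kN).
- exact: (cvg_comp _ _ (@cvg_addnl k) (@cvgr_idn R)).
- move=> j jk; suff H : p * b N j / N%:R @[N --> \oo] --> (1 : R).
    exact: (cvg_comp _ _ (@cvg_addnl k) H).
  apply/cvgrPdist_le => e e0; have /eqaddoP/(_ e e0) := bo (Ordinal jk).
  move=> H; near=> N.
  have N0 : 0 < N%:R :> R by rewrite ltr0n; near: N; exact: nbhs_infty_gt.
  have : `|p * b N j - N%:R| <= e * `|N%:R : R| by near: N; exact: H.
  rewrite (gtr0_norm N0) => h.
  rewrite (_ : 1 - _ = - (p * b N j - N%:R) / N%:R); last by field; rewrite gt_eqF.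
  by rewrite normrM normrN normfV (gtr0_norm N0) ler_pdivrMr.
- exact: measurable_sign_avg.
- by move=> t; exact: sign_avg_ge0.
- by move=> t; exact: sign_avg_le.
Unshelve. all: by end_near. Qed.
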